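(* Let $M$ be a stationary rotating surface (with respect to the $x_3$-axis), with $2H(x)=ar^2+b$, $a,b\in\mathbb{R}$, that is a graph on some horizontal domain $\Omega\subset\mathbb{R}^2$. Then $M$ is strongly stable. Moreover, the following property of the energy holds. Let $y:M'\to\mathbb{R}^3$ be an immersion of a compact oriented surface $M'$ with the same boundary as $M$, such that $M\cup M'$ defines an oriented 3-chain $W$. If $M'$ is included in the vertical solid cylinder $\Omega\times\mathbb{R}$ (i.e. $y(M'\setminus\partial M')\subset\Omega\times\mathbb{R}$), then $E(M)\le E(y)$.
   Context: Coordinates of $\mathbb{R}^3$ are $(x_1,x_2,x_3)$, $r=\sqrt{x_1^2+x_2^2}$, $E_3=(0,0,1)$. A stationary rotating surface (with respect to the $x_3$-axis) is an oriented compact connected surface $M$ smoothly immersed in $\mathbb{R}^3$ by $x$, with Gauss map $N$, whose mean curvature $H$ satisfies $2H(x)=ar^2+b$ at every point for constants $a,b\in\mathbb{R}$, where $2H$ is the sum of the principal curvatures with respect to $N$ (sign convention $\Delta x=2HN$). Being a graph on $\Omega$ means $M$ is the graph $x_3=u(x_1,x_2)$ of a smooth function over (the closure of) $\Omega$. Write $N_3=\langle N,E_3\rangle$, $h=\langle N,x\rangle$ (support function), $\sigma$ for the second fundamental form and $\Delta$ for the Laplacian of the induced metric. The surface is strongly stable if $$-\int_M f\Bigl(\Delta f+\bigl(|\sigma|^2-2a(h-x_3N_3)\bigr)f\Bigr)\,dM\ge0$$ for all $f\in C_0^\infty(M)$ (smooth functions compactly supported in $M\setminus\partial M$). For fixed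 $a,b$, the energy of an oriented immersed compact surface with Gauss map $N$ is $$E=\int_M 1\,dM+a\int_M r^2x_3N_3\,dM+b\int_M x_3N_3\,dM.$$ $E(y)$ is computed with the same $a,b$ as for $M$ and with the Gauss map $N'$ of $M'$ induced by $W$. The orientations are such that $M-M'$ is the oriented boundary of the 3-chain $W$ (up to a global sign), i.e. $\int_M\langle Z,N\rangle\,dM=\int_{M'}\langle Z,N'\rangle\,dM'$ for every divergence-free smooth vector field $Z$. *)

(* Defs.v *)
From HB Require Import structures.
From mathcomp Require Import all_boot all_order all_algebra.
From mathcomp Require Import all_classical all_reals all_analysis.

Set Implicit Arguments.
Unset Strict Implicit.
Unset Printing Implicit Defensive.
Import Order.TTheory GRing.Theory Num.Theory.
Import numFieldNormedType.Exports.

Local Open Scope classical_set_scope.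
Local Open Scope ring_scope.

(* C^oo on the open set U: all iterated directional derivatives of f exist
   and are continuous at every point of U. *)
Definition smooth_on (R : realType) (V W : normedModType R)
    (U : set V) (f : V -> W) : Prop :=
  forall (vs : seq V) (p : V), U p ->
    let g := foldr (fun v h => 'D_v h) f vs in
    {for p, continuous g} /\ forall v, derivable g p v.

Section EuclideanSpace.
Variable R : realType.

Definition dot (v w : 'rV[R]_3) : R := \sum_(k < 3) v 0 k * w 0 k.

Definition x1 (v : 'rV[R]_3) : R := v 0 0.
Definition x2 (v : 'rV[R]_3) : R := v 0 1.
Definition x3 (v : 'rV[R]_3) : R := v 0 2.

(* r^2 = x_1^2 + x_2^2, the squared distance to the rotation axis *)
Definition rsq (v : 'rV[R]_3) : R := x1 v ^+ 2 + x2 v ^+ 2.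

Definition E3 : 'rV[R]_3 := delta_mx 0 2.

Definition hproj (v : 'rV[R]_3) : R * R := (x1 v, x2 v).

Definition divergence (Z : 'rV[R]_3 -> 'rV[R]_3) (v : 'rV[R]_3) : R :=
  \sum_(k < 3) 'D_(delta_mx 0 k) Z v 0 k.

End EuclideanSpace.

Section LocalGeometry.
Variable R : realType.

Definition e2 (i : 'I_2) : R * R := if i == 0 then (1, 0) else (0, 1).

Definition first_form (X : R * R -> 'rV[R]_3) (p : R * R) : 'M[R]_2 :=
  \matrix_(i, j) dot ('D_(e2 i) X p) ('D_(e2 j) X p).

Definition second_form (X : R * R -> 'rV[R]_3) (n : 'rV[R]_3) (p : R * R) :
    'M[R]_2 :=
  \matrix_(i, j) dot ('D_(e2 i) ('D_(e2 j) X) p) n.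

Definition shape_op X n p : 'M[R]_2 :=
  invmx (first_form X p) *m second_form X n p.

(* The eigenvalues of the shape operator are the principal curvatures; with
   h_ij = <X_ij, n> one has Delta X = 2 H n. *)
Definition mean_curv X n p : R := \tr (shape_op X n p) / 2.

(* |sigma|^2 = g^ik g^jl h_ij h_kl *)
Definition sff_sqnorm X n p : R := \tr (shape_op X n p *m shape_op X n p).

Definition area_density X p : R := Num.sqrt (\det (first_form X p)).

(* Laplace-Beltrami operator of the metric induced by X, in coordinates *)
Definition local_laplacian (X : R * R -> 'rV[R]_3) (F : R * R -> R)
    (p : R * R) : R :=
  (area_density X p)^-1 *
  \sum_(i < 2) 'D_(e2 i) (fun q => area_density X q *
    \sum_(j < 2) invmx (first_form X q) i j * 'D_(e2 j) F q) p.

Definition half (V : set (R * R)) : set (R * R) :=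
  V `&` [set p | 0 <= p.2].

(* phi : half V -> S is a local parametrization (inverse chart) of the surface
   immersed by x: a homeomorphism of the relatively open subset half V of the
   closed half-plane onto an open subset of S, such that x \o phi is a smooth
   immersion.  Smoothness up to the boundary line means that x \o phi is the
   restriction of a smooth map X on the open set V; the derivatives of X at
   points of half V depend only on x \o phi.  Transition maps between two such
   parametrizations are automatically smooth, so that the parametrizations
   form the (maximal) atlas for which x is an immersion. *)
Record local_param (S : topologicalType) (x : S -> 'rV[R]_3)
    (V : set (R * R)) (phi : R * R -> S) (X : R * R -> 'rV[R]_3) : Prop := {
  lp_open : open V;
  lp_smooth : smooth_on V X;
  lp_imm : forall p, half V p -> X p = x (phi p);
  lp_immersive : forall p, half V p -> forall v, 'D_v X p = 0 -> v = 0;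
  lp_inj : {in half V &, injective phi};
  lp_cont : {within half V, continuous phi};
  lp_openmap : forall U, open U -> open (phi @` (U `&` half V))
}.

End LocalGeometry.

Notation borel S := (g_sigma_algebraType (@open S)).

(* Compact surface with (possibly empty) boundary, immersed in R^3 and oriented
   by its Gauss map.  The area measure is the unique Borel measure with density
   sqrt (det g) in every local parametrization.  The carrier is pointed, i.e.
   nonempty, as measurable types are in the library. *)
Record oriented_surface (R : realType) := {
  carrier :> ptopologicalType;
  imm : carrier -> 'rV[R]_3;
  gauss : carrier -> 'rV[R]_3;
  area : {measure set (borel carrier) -> \bar R};
  surf_hausdorff : hausdorff_space carrier;
  surf_compact : compact [set: carrier];
  surf_cover : forall s : carrier, exists V phi X,
    local_param imm V phi X /\ (phi @` half V) s;
  gauss_cont : continuous gauss;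
  gauss_unit : forall s, dot (gauss s) (gauss s) = 1;
  gauss_normal : forall V phi X, local_param imm V phi X ->
    forall p, half V p -> forall v, dot (gauss (phi p)) ('D_v X p) = 0;
  area_param : forall V phi X, local_param imm V phi X ->
    forall A : set (measurableTypeR R * measurableTypeR R),
      measurable A -> A `<=` half V ->
      area (phi @` A) =
        (\int[lebesgue_measure \x lebesgue_measure]_(p in A)
           (area_density X p)%:E)%E
}.

Section Surfaces.
Variable R : realType.
Implicit Types M : oriented_surface R.

Definition boundary M : set M :=
  [set s | exists V phi X, local_param (@imm R M) V phi X /\
             exists p, [/\ V p, p.2 = 0 & phi p = s]].

Definition N3 M (s : M) : R := dot (gauss s) (E3 R).

Definition support_fun M (s : M) : R := dot (gauss s) (imm s).

(* 2 H = a r^2 + b at every point of the compact connected surface M *)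
Definition stationary_rotating M (a b : R) : Prop :=
  connected [set: M] /\
  forall V phi X, local_param (@imm R M) V phi X -> forall p, half V p ->
    2 * mean_curv X (gauss (phi p)) p = a * rsq (imm (phi p)) + b.

(* F is f read in the parametrization phi (smoothly extended from half V to
   V). *)
Definition coord_expr M (f : M -> R) (V : set (R * R)) (phi : R * R -> M)
    (F : R * R -> R) : Prop :=
  smooth_on V F /\ forall p, half V p -> F p = f (phi p).

Definition smooth_fun M (f : M -> R) : Prop :=
  forall V phi X, local_param (@imm R M) V phi X ->
    exists F, coord_expr f V phi F.

(* The next two predicates determine Lf and q uniquely, since the local
   expressions are invariant under change of parametrization. *)
Definition is_laplacian M (f Lf : M -> R) : Prop :=
  forall V phi X F, local_param (@imm R M) V phi X -> coord_expr f V phi F ->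
    forall p, half V p -> Lf (phi p) = local_laplacian X F p.

Definition is_sff_sqnorm M (q : M -> R) : Prop :=
  forall V phi X, local_param (@imm R M) V phi X ->
    forall p, half V p -> q (phi p) = sff_sqnorm X (gauss (phi p)) p.

Definition test_fun M (f : M -> R) : Prop :=
  let K := closure [set s | f s != 0] in
  [/\ smooth_fun f, compact K & K `<=` ~` boundary (M := M)].

Definition strongly_stable M (a : R) : Prop :=
  forall q f Lf : M -> R,
    is_sff_sqnorm q -> test_fun f -> is_laplacian f Lf ->
    0 <= - \int[area M]_s
      (f s * (Lf s +
        (q s - 2 * a * (support_fun s - x3 (imm s) * N3 s)) * f s)).

Definition energy (a b : R) M : R :=
  \int[area M]_s 1
  + a * \int[area M]_s (rsq (imm s) * x3 (imm s) * N3 s)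
  + b * \int[area M]_s (x3 (imm s) * N3 s).

Definition domain (Omega : set (R * R)) : Prop :=
  [/\ open Omega, connected Omega & Omega !=set0].

Definition graph (D : set (R * R)) (u : R * R -> R) : set 'rV[R]_3 :=
  [set v | D (hproj v) /\ x3 v = u (hproj v)].

(* M is the graph of u over the closure of Omega, its interior being the part
   over Omega.  A smooth function on the closed set closure Omega is the
   restriction of a smooth function on the plane. *)
Definition graph_on M (Omega : set (R * R)) (u : R * R -> R) : Prop :=
  [/\ smooth_on [set: R * R] u,
      injective (@imm R M),
      @imm R M @` (~` boundary (M := M)) = graph Omega u &
      @imm R M @` [set: M] = graph (closure Omega) u].

Definition same_boundary M M' : Prop :=
  @imm R M @` boundary (M := M) = @imm R M' @` boundary (M := M').

Definition flux M (Z : 'rV[R]_3 -> 'rV[R]_3) : R :=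
  \int[area M]_s dot (Z (imm s)) (gauss s).

(* M - M' is, up to a global sign, the oriented boundary of a 3-chain: stated
   through the equality of the fluxes of every divergence-free smooth vector
   field of R^3. *)
Definition bound_chain M M' : Prop :=
  forall Z : 'rV[R]_3 -> 'rV[R]_3, smooth_on [set: 'rV[R]_3] Z ->
    (forall v, divergence Z v = 0) -> flux M Z = flux M' Z.

End Surfaces.

(* Main.v *)
Require Import Defs.
From HB Require Import structures.
From mathcomp Require Import all_boot all_order all_algebra.
From mathcomp Require Import all_classical all_reals all_analysis.
From mathcomp Require Import measurable_realfun ring lra.

(* Over Omega the surface is x_3 = u with unit normal eps (-Du, 1) / W,
   W = sqrt (1 + |Du|^2), and 2H = a r^2 + b reads eps div (Du / W) = a r^2 + b.

   Energy: the field Z = eps (-Du / W, 1 / W + x_3 div (Du / W)), defined with a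
   smooth extension of u, is divergence free on the whole of R^3.  Its flux
   through M is E(M), while Cauchy-Schwarz bounds its flux through any surface
   lying over the closure of Omega by the energy of that surface.

   Stability: 1 / W is a positive solution of the Jacobi equation, because
   vertical translations preserve the equation for the mean curvature.
   Comparing a test function F with it, - F L F dM becomes, in the graph chart,
   a divergence plus the value of the quadratic form sqrt (det g) g^ij at
   DF + F DW / W.  All points of M over Omega are covered by the single graph
   chart, once Omega has been translated into the open upper half-plane. *)

Set Implicit Arguments.
Unset Strict Implicit.
Unset Printing Implicit Defensive.
Import Order.TTheory GRing.Theory Num.Theory.
Import numFieldNormedType.Exports.

Local Open Scope classical_set_scope.
Local Open Scope ring_scope.

(** * Smooth functions *)

Section Smoothness.
Variable R : realType.

(** Two difficulties shape the argument. First, the chart over the interior gives the normal only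
    over Omega and only up to a sign that may depend on the point. Compactness of M carries what
    holds there to the whole surface, and connectedness then makes the sign one constant eps. The
    curvature equation likewise passes to the closure of Omega by continuity, which matters because
    the energy comparison evaluates it at boundary points too. Second, nothing is assumed about the
    regularity of the boundary of Omega, so integration by parts takes place on the whole plane: u
    is already smooth there, a test function is extended by zero, and the fundamental theorem of
    calculus is applied on a large square. The area measure, prescribed only on images of charts,
    reaches the plane as a push-forward with density W over Omega. The translation is forced by the
    form of parametrizations: they see only the part p.2 >= 0 of their domain, and the line p.2 = 0
    stands for the boundary of M. *)

Lemma smooth_on_derive (V W : normedModType R) (U : set V) (f : V -> W) v :
  smooth_on U f -> smooth_on U ('D_v f).
Proof. by move=> fs vs p Up; have := fs (rcons vs v) p Up; rewrite foldr_rcons. Qed.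

Lemma smooth_on_continuous (V W : normedModType R) (U : set V) (f : V -> W) p :
  smooth_on U f -> U p -> {for p, continuous f}.
Proof. by move=> fs Up; have [] := fs [::] p Up. Qed.

Lemma smooth_on_derivable (V W : normedModType R) (U : set V) (f : V -> W) p v :
  smooth_on U f -> U p -> derivable f p v.
Proof. by move=> fs Up; have [_] := fs [::] p Up; apply. Qed.

(** By induction on the list of directions, only one derivative at a time has to be examined. Later
    smoothness proofs thus amount to choosing a class [P] stable under ['D_v], and no formula for
    iterated derivatives is ever written. *)
Lemma smooth_on_coind (V W : normedModType R) (U : set V)
    (P : (V -> W) -> Prop) :
  (forall f, P f -> (forall p, U p -> {for p, continuous f}) /\
     (forall p v, U p -> derivable f p v) /\ (forall v, P ('D_v f))) ->
  forall f, P f -> smooth_on U f.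
Proof.
move=> HP f Pf vs p Up.
have : P (foldr (fun v h => 'D_v h) f vs).
  by elim: vs => [//|v vs IH] /=; have [_ [_]] := HP _ IH; apply.
by move=> /HP [cg [dg _]]; split; [exact: cg|move=> v; exact: dg].
Qed.

Lemma smooth_onS (V W : normedModType R) (U U' : set V) (f : V -> W) :
  U `<=` U' -> smooth_on U' f -> smooth_on U f.
Proof. by move=> UU' fs vs p /UU'; exact: fs. Qed.

(** A directional derivative depends only on the increments along a line. Translations, linear
    substitutions and restrictions to lines are all handled through this remark, without
    differentiability in the sense of Fréchet. *)
Lemma eq_growth_derive (V V' W : normedModType R) (f : V -> W) (g : V' -> W) a v b w :
  (forall h : R, f (h *: v + a) - f a = g (h *: w + b) - g b) ->
  'D_v f a = 'D_w g b.
Proof.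
move=> fg; rewrite /derive.
set F := fun h : R => h^-1 *: _; set G := fun h : R => h^-1 *: (_ - g b).
by suff -> : F = G by []; apply/funext => h; rewrite /F /G /= fg.
Qed.

Lemma eq_growth_derivable (V V' W : normedModType R) (f : V -> W) (g : V' -> W) a v b w :
  (forall h : R, f (h *: v + a) - f a = g (h *: w + b) - g b) ->
  derivable g b w -> derivable f a v.
Proof.
move=> fg; rewrite /derivable.
set G := fun h : R => h^-1 *: (_ - g b); set F := fun h : R => h^-1 *: _.
by suff -> : F = G by []; apply/funext => h; rewrite /F /G /= fg.
Qed.

(* This class is closed under directional derivatives, hence consists of smooth
   functions by [smooth_on_coind]. *)
Inductive smooth_expr (V : normedModType R) : (V -> R) -> Prop :=
| smooth_expr_base f : smooth_on [set: V] f -> smooth_expr f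
| smooth_expr_cst k : smooth_expr (fun=> k)
| smooth_expr_add f g :
    smooth_expr f -> smooth_expr g -> smooth_expr (fun p => f p + g p)
| smooth_expr_mul f g :
    smooth_expr f -> smooth_expr g -> smooth_expr (fun p => f p * g p)
| smooth_expr_rsqrt f : smooth_expr f -> (forall p, 0 < f p) ->
    smooth_expr (fun p => (Num.sqrt (f p))^-1).

Lemma is_derive_rsqrt (x : R) : 0 < x ->
  is_derive x 1 (fun y => (Num.sqrt y)^-1) (- (2^-1 * (Num.sqrt x)^-1 ^+ 3)).
Proof.
move=> x0; have s0 : Num.sqrt x != 0 by rewrite gt_eqF// sqrtr_gt0.
have [ds es] := is_derive1_sqrt x0.
apply: (@DeriveDef _ _ _ _ _ (fun y => (Num.sqrt y)^-1)).
  exact: (@derivableV _ _ (@Num.sqrt R)).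
rewrite (@deriveV _ _ (@Num.sqrt R))// es /GRing.scale/=.
by field.
Qed.

Lemma is_derive_comp1 (V : normedModType R) (f : V -> R) (g : R -> R)
    (p v : V) (df dg : R) :
  is_derive p v f df -> is_derive (f p) 1 g dg ->
  is_derive p v (fun q => g (f q)) (dg * df).
Proof.
move=> [fd fe] [gd ge].
(* Restricting [f] to the line through [p] in direction [v] reduces the claim to the one-variable
   chain rule at parameter 0. *)
have fd1 := (derivable1P f p v).1 fd.
have gd1 : derivable g (f ((0 : R) *: v + p)) 1 by rewrite scale0r add0r.
have key : derivable (g \o (fun h : R => f (h *: v + p))) 0 1.
  by apply/derivable1_diffP; apply: differentiable_comp; apply/derivable1_diffP.
apply: DeriveDef; first exact/derivable1P.
have := derive1_comp fd1 gd1.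
rewrite !derive1E scale0r add0r ge.
have E (h : V -> R) : 'D_1 (fun k : R => h (k *: v + p)) 0 = 'D_v h p.
  by apply: eq_growth_derive => k; rewrite addr0 scale0r add0r [_%:A]mulr1.
by rewrite E fe => <-; rewrite -(E (g \o f)).
Qed.

Lemma smooth_expr_smooth (V : normedModType R) (f : V -> R) :
  smooth_expr f -> smooth_on [set: V] f.
Proof.
move: f; apply: smooth_on_coind => f; elim=> {f}.
- move=> f fs; split=> [p|]; first exact: smooth_on_continuous.
  split=> [p v|v]; first exact: smooth_on_derivable.
  exact/smooth_expr_base/smooth_on_derive.
- move=> k; split=> [p _|]; first exact: cvg_cst.
  split=> [p v _|v]; first exact: derivable_cst.
  rewrite (_ : 'D_v _ = fun=> 0); first exact: smooth_expr_cst.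
  by apply/funext => p; exact: derive_cst.
- move=> f g _ [cf [df sf]] _ [cg [dg sg]]; split=> [p _|].
    by apply: continuousD; [exact: cf|exact: cg].
  split=> [p v _|v].
    by apply: derivableD; [exact: df|exact: dg].
  rewrite (_ : 'D_v _ = fun p => 'D_v f p + 'D_v g p).
    exact: smooth_expr_add.
  by apply/funext => p; rewrite deriveD; [|exact: df|exact: dg].
- move=> f g ef [cf [df sf]] eg [cg [dg sg]]; split=> [p _|].
    by apply: continuousM; [exact: cf|exact: cg].
  split=> [p v _|v].
    by apply: derivableM; [exact: df|exact: dg].
  rewrite (_ : 'D_v _ = fun p => f p * 'D_v g p + g p * 'D_v f p).
    by apply: smooth_expr_add; exact: smooth_expr_mul.
  by apply/funext => p; rewrite deriveM; [|exact: df|exact: dg].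
- move=> f ef [cf [df sf]] f0.
  have H p v : is_derive p v (fun p => (Num.sqrt (f p))^-1)
      (- (2^-1 * (Num.sqrt (f p))^-1 ^+ 3) * 'D_v f p).
    apply: (is_derive_comp1 (g := fun y => (Num.sqrt y)^-1)).
      exact/derivableP/df.
    exact: is_derive_rsqrt.
  split=> [p _|].
    apply: continuousV; first by rewrite gt_eqF// sqrtr_gt0.
    apply: continuous_comp; first exact: cf.
    exact: sqrt_continuous.
  split=> [p v _|v]; first by have [] := H p v.
  (* The derivative is -1/2 (f^(-1/2))^3 Df, again a product of members of the class: this is why
     the inverse square root is taken as a single constructor. *)
  rewrite (_ : 'D_v _ = fun p => (- 2^-1) * ((Num.sqrt (f p))^-1 *
     ((Num.sqrt (f p))^-1 * (Num.sqrt (f p))^-1)) * 'D_v f p); last first.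
    by apply/funext => p; have [_ ->] := H p v; rewrite !exprS expr0; ring.
  have ew := smooth_expr_rsqrt ef f0.
  apply: smooth_expr_mul => //; apply: smooth_expr_mul.
    exact: smooth_expr_cst.
  by do 2! apply: smooth_expr_mul => //.
Qed.

Lemma derive_precomp (V V' W : normedModType R) (L : {linear V -> V'})
    (f : V' -> W) v p : 'D_v (f \o L) p = 'D_(L v) f (L p).
Proof. by apply: eq_growth_derive => h /=; rewrite linearD linearZ. Qed.

Lemma derivable_precomp (V V' W : normedModType R) (L : {linear V -> V'})
    (f : V' -> W) v p : derivable f (L p) (L v) -> derivable (f \o L) p v.
Proof. by apply: eq_growth_derivable => h /=; rewrite linearD linearZ. Qed.

Lemma smooth_on_precomp (V V' W : normedModType R) (L : {linear V -> V'})
    (f : V' -> W) : continuous L ->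
  smooth_on [set: V'] f -> smooth_on [set: V] (f \o L).
Proof.
move=> cL fs.
apply: (@smooth_on_coind _ _ _ (fun h => exists2 g, smooth_on [set: V'] g & h = g \o L));
  last by exists f.
move=> _ [g gs ->]; split=> [p _|].
  apply: continuous_comp; first exact: cL.
  exact: smooth_on_continuous gs _.
split=> [p v _|v].
  apply: derivable_precomp; exact: smooth_on_derivable gs _.
exists ('D_(L v) g); first exact: smooth_on_derive.
by apply/funext => p; exact: derive_precomp.
Qed.

Lemma smooth_on_shift (V W : normedModType R) (c : V) (f : V -> W) :
  smooth_on [set: V] f -> smooth_on [set: V] (fun p => f (p - c)).
Proof.
move=> fs.
apply: (@smooth_on_coind _ _ _ (fun h => exists2 g, smooth_on [set: V] g &
  h = fun p => g (p - c))); last by exists f.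
have E (g : V -> W) v p : 'D_v (fun p => g (p - c)) p = 'D_v g (p - c).
  by apply: eq_growth_derive => h /=; rewrite addrA.
move=> _ [g gs ->]; split=> [p _|].
  apply: (@continuous_comp _ _ _ (fun p => p - c)).
    by apply: continuousB; [exact: cvg_id|exact: cvg_cst].
  exact: smooth_on_continuous gs _.
split=> [p v _|v].
  apply: eq_growth_derivable (@smooth_on_derivable _ _ _ _ (p - c) v gs I) => h.
  by rewrite addrA.
exists ('D_v g); first exact: smooth_on_derive.
by apply/funext => p; exact: E.
Qed.

Lemma continuous_row (T : topologicalType) n (f : 'I_n -> T -> R) p :
  (forall k, {for p, continuous (f k)}) ->
  {for p, continuous (fun q => \row_k f k q)}.
Proof.
move=> cf; apply/cvgrPdist_le => e e0.
near=> q.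
rewrite /Num.Def.normr/= mx_normrE (bigmax_le _ (ltW e0))//= => -[i j] _.
rewrite !mxE /=; move: {i} j; near: q; apply: filter_forall => j.
by move/cvgrPdist_le: (cf j); exact.
Unshelve. all: by end_near. Qed.

Lemma derivable_row (V : normedModType R) n (f : 'I_n -> V -> R) p v :
  (forall k, derivable (f k) p v) -> derivable (fun q => \row_k f k q) p v.
Proof.
move=> df; apply/derivable_mxP => i j.
by rewrite (_ : (fun _ => _) = f j)//; apply/funext => q; rewrite mxE.
Qed.

Lemma derive_row (V : normedModType R) n (f : 'I_n -> V -> R) p v :
  (forall k, derivable (f k) p v) ->
  'D_v (fun q => \row_k f k q) p = \row_k 'D_v (f k) p.
Proof.
move=> df; rewrite derive_mx; last exact: derivable_row.
apply/rowP => k; rewrite !mxE; congr ('D_v _ p).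
by apply/funext => q; rewrite mxE.
Qed.

Lemma smooth_on_row (V : normedModType R) n (f : 'I_n.+1 -> V -> R) :
  (forall k, smooth_on setT (f k)) -> smooth_on setT (fun q => \row_k f k q).
Proof.
move=> fs.
apply: (@smooth_on_coind _ _ _ (fun h => exists2 g,
  (forall k, smooth_on setT (g k)) & h = fun q => \row_k g k q)); last by exists f.
move=> _ [g gs ->]; split=> [p _|].
  apply: continuous_row => k; exact: smooth_on_continuous (gs k) _.
have dg p v k : derivable (g k) p v by exact: smooth_on_derivable (gs k) _.
split=> [p v _|v]; first exact: derivable_row.
exists (fun k => 'D_v (g k)); first by move=> k; exact: smooth_on_derive.
by apply/funext => p; rewrite derive_row.
Qed.

End Smoothness.

Arguments smooth_on_derive {R V W U f} v _.

(** * Extension by zero, and symmetry of second derivatives *)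

Section ExtensionAndSymmetry.
Variable R : realType.

Definition zero_extension (V W : normedModType R) (O : set V) (F : V -> W) p : W :=
  if p \in O then F p else 0.

(** The open sets [O] and the complement of [K] cover the space because [K] lies in [O]. Near a
    point of the first the extension is [F], near a point of the second it is 0, and both
    descriptions survive differentiation. *)
Lemma smooth_on_zero_extension (V W : normedModType R) (O K : set V) (F : V -> W) :
  open O -> closed K -> K `<=` O -> smooth_on O F ->
  (forall p, O p -> ~ K p -> F p = 0) -> smooth_on setT (zero_extension O F).
Proof.
move=> oO cK KO Fs F0.
apply: (@smooth_on_coind _ _ _ _ (fun h => exists g, [/\ smooth_on O g,
  forall p, O p -> ~ K p -> g p = 0 & h = zero_extension O g])); last by exists F.
move=> _ [g [gs g0 ->]].
have nO p : O p -> \near p, g p = (zero_extension O g) p.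
  move=> Op; have := open_nbhs_nbhs (conj oO Op); apply: filterS => q Oq.
  by rewrite /zero_extension mem_set.
have nK p : ~ K p -> \near p, (0 : W) = (zero_extension O g) p.
  move=> Kp; have := open_nbhs_nbhs (conj (closed_openC cK) Kp).
  apply: filterS => q Kq; rewrite /zero_extension; case: ifPn => //.
  by rewrite inE => Oq; rewrite g0.
have OK : forall q, ~ O q -> ~ K q by move=> q nOq Kq; exact/nOq/KO.
split=> [p _|].
  have [Op|/OK Kp] := pselect (O p).
    rewrite /prop_for/continuous_at -(nbhs_singleton (nO p Op)).
    have gp : g @ p --> g p by exact: smooth_on_continuous gs Op.
    exact: cvg_trans (near_eq_cvg (nO p Op)) gp.
  rewrite /prop_for/continuous_at -(nbhs_singleton (nK p Kp)).
  exact: cvg_trans (near_eq_cvg (f := cst 0) (nK p Kp)) (cvg_cst _).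
split=> [p v _|v].
  have [Op|/OK Kp] := pselect (O p).
    by apply: near_eq_derivable (nO p Op) _; exact: smooth_on_derivable Op.
  apply: (near_eq_derivable (f := cst 0)); first exact: nK.
  exact: derivable_cst.
have DE p : ~ K p -> 'D_v (zero_extension O g) p = 0.
  by move=> Kp; rewrite -(near_eq_derive v (f := cst 0) (nK p Kp)) derive_cst.
have DO p : O p -> 'D_v g p = 'D_v (zero_extension O g) p.
  by move=> Op; apply: near_eq_derive; exact: nO.
exists ('D_v g); split; first exact: smooth_on_derive.
  by move=> p Op Kp; rewrite DO// DE.
apply/funext => p; rewrite /zero_extension; case: ifPn => [/set_mem/DO->//|].
by rewrite notin_setE => /OK; exact: DE.
Qed.

Lemma is_derive_line (V : normedModType R) (g : V -> R) (q v : V) (s : R) :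
  smooth_on setT g ->
  is_derive s (1 : R) (fun s : R => g (q + s *: v)) ('D_v g (q + s *: v)).
Proof.
move=> gs.
have E (h : R) : g (q + (h *: (1 : R) + s) *: v) - g (q + s *: v) =
    g (h *: v + (q + s *: v)) - g (q + s *: v).
  by rewrite [h *: 1]mulr1 scalerDl addrCA.
apply: DeriveDef; last exact: (eq_growth_derive E).
exact: (eq_growth_derivable (f := fun s : R => g (q + s *: v)) E
  (smooth_on_derivable gs I)).
Qed.

Lemma MVT_from0 (g : R -> R) (dg : R -> R) (t : R) :
  0 < t -> (forall s : R, is_derive s (1 : R) g (dg s)) ->
  exists2 s, 0 < s < t & g t - g 0 = dg s * t.
Proof.
move=> t0 dgP.
have [|s st ->] := @MVT _ g dg 0 t t0 (fun s _ => dgP s).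
  apply: continuous_subspaceT => s.
  apply: differentiable_continuous; apply/derivable1_diffP.
  by have [] := dgP s.
by exists s; [move: st; rewrite in_itv|rewrite subr0].
Qed.

(** Mean value theorem twice: along [v] for the increment of [g] by [t *: w], then along [w] for
    ['D_v g]. The left side is symmetric in [v] and [w], which is what the exchange of derivatives
    exploits. *)
Lemma second_difference (V : normedModType R) (g : V -> R) (p v w : V) (t : R) :
  smooth_on setT g -> 0 < t ->
  exists r s, [/\ 0 < r < t, 0 < s < t &
    g (p + t *: v + t *: w) - g (p + t *: v) - g (p + t *: w) + g p =
    'D_w ('D_v g) (p + r *: v + s *: w) * (t * t)].
Proof.
move=> gs t0.
have dphi (r : R) : is_derive r (1 : R)
    (fun r : R => g (p + t *: w + r *: v) - g (p + r *: v))
    ('D_v g (p + t *: w + r *: v) - 'D_v g (p + r *: v)).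
  by apply: is_deriveB; exact: is_derive_line.
have [r rt] := @MVT_from0 _ _ t t0 dphi.
rewrite scale0r !addr0 => Er.
have dpsi (s : R) : is_derive s (1 : R)
    (fun s : R => 'D_v g (p + r *: v + s *: w)) ('D_w ('D_v g) (p + r *: v + s *: w)).
  by apply: is_derive_line; exact: smooth_on_derive.
have [s st] := @MVT_from0 _ _ t t0 dpsi.
rewrite scale0r addr0 => Es.
exists r, s; split => //; rewrite mulrA -Es (addrAC _ (r *: v)) -Er (addrAC _ (t *: v)).
by ring.
Qed.

Lemma continuous_corner (V : normedModType R) (h : V -> R) (p v w : V) (e : R) :
  {for p, continuous h} -> 0 < e ->
  \forall t \near 0^'+, forall r s : R, 0 < r < t -> 0 < s < t ->
    `|h p - h (p + r *: v + s *: w)| < e.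
Proof.
move=> /cvgrPdist_lt c /c /nbhs_ballP[d /= d0 dB].
(* The displacement of [p] has norm at most [t * C]; the summand 1 keeps [C] positive when [v] and
   [w] both vanish. *)
pose C := `|v| + `|w| + 1.
have C0 : 0 < C by rewrite /C ltr_wpDl// addr_ge0.
near=> t => r s /andP[r0 rt] /andP[s0 st].
apply: dB; rewrite -ball_normE/= -(addrA p) opprD addrA subrr add0r normrN.
rewrite (le_lt_trans (ler_normD _ _))// !normrZ !gtr0_norm//.
apply: (@le_lt_trans _ _ (t * C)); last first.
  by rewrite -ltr_pdivlMr//; near: t; apply: nbhs_right_lt; rewrite divr_gt0.
rewrite /C; have := normr_ge0 v; have := normr_ge0 w.
move: `|v| `|w| => x y; nra.
Unshelve. all: by end_near. Qed.

Lemma ler_dist_half (x y z e : R) :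
  `|x - z| < e / 2 -> `|y - z| < e / 2 -> `|x - y| <= e.
Proof.
move=> xz yz; rewrite -(subrKA z) (splitr e) (le_trans (ler_normD _ _))// lerD ?ltW//.
by rewrite distrC.
Qed.

(* Both mixed derivatives are nearby values of the same second difference. *)
Lemma derive_comm (V : normedModType R) (g : V -> R) (p v w : V) :
  smooth_on setT g -> 'D_w ('D_v g) p = 'D_v ('D_w g) p.
Proof.
move=> gs.
have c v' w' : {for p, continuous ('D_w' ('D_v' g))}.
  exact: (@smooth_on_continuous _ _ _ setT _ p (@smooth_on_derive _ _ _ _ _ w'
      (@smooth_on_derive _ _ _ _ _ v' gs))).
apply/eqP; rewrite -subr_eq0 -normr_le0; apply/ler_addgt0Pl => e e0.
have e20 : 0 < e / 2 by rewrite divr_gt0.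
have H : \forall t \near (0 : R)^'+,
  (forall r s : R, 0 < r < t -> 0 < s < t ->
    `|'D_w ('D_v g) p - 'D_w ('D_v g) (p + r *: v + s *: w)| < e / 2) /\
  (forall r s : R, 0 < r < t -> 0 < s < t ->
    `|'D_v ('D_w g) p - 'D_v ('D_w g) (p + r *: w + s *: v)| < e / 2) /\ 0 < t.
  apply: filterI; first exact: continuous_corner (c v w) e20.
  apply: filterI; first exact: continuous_corner (c w v) e20.
  exact: nbhs_right_gt.
have [t [H1 [H2 t0]]] := filter_ex H.
have [r1 [s1 [r1t s1t E1]]] := second_difference p v w gs t0.
have [r2 [s2 [r2t s2t E2]]] := second_difference p w v gs t0.
have S1 : `|'D_w ('D_v g) p - 'D_w ('D_v g) (p + r1 *: v + s1 *: w)| < e / 2.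
  exact: H1.
have S2 : `|'D_v ('D_w g) p - 'D_v ('D_w g) (p + r2 *: w + s2 *: v)| < e / 2.
  exact: H2.
have E : 'D_w ('D_v g) (p + r1 *: v + s1 *: w) =
    'D_v ('D_w g) (p + r2 *: w + s2 *: v).
  have tt0 : t * t != 0 by rewrite mulf_neq0// gt_eqF.
  apply: (mulIf tt0); apply: (etrans (esym E1)); apply: (etrans _ E2).
  by rewrite (addrAC p (t *: v)) (addrAC (g _)).
rewrite E in S1; rewrite addr0.
exact: ler_dist_half S1 S2.
Qed.

End ExtensionAndSymmetry.

(* Otherwise closing tactics and term matching unfold derivatives to limits. *)
Local Opaque smooth_on derive.

Section SmoothAlgebra.
Variable R : realType.

Lemma smooth_mul (V : normedModType R) (f g : V -> R) :
  smooth_on setT f -> smooth_on setT g -> smooth_on setT (fun p => f p * g p).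
Proof.
by move=> fs gs; apply/smooth_expr_smooth/smooth_expr_mul; exact: smooth_expr_base.
Qed.

Lemma smooth_add (V : normedModType R) (f g : V -> R) :
  smooth_on setT f -> smooth_on setT g -> smooth_on setT (fun p => f p + g p).
Proof.
by move=> fs gs; apply/smooth_expr_smooth/smooth_expr_add; exact: smooth_expr_base.
Qed.

Lemma smooth_cst (V : normedModType R) (k : R) :
  smooth_on setT (fun _ : V => k).
Proof. exact/smooth_expr_smooth/smooth_expr_cst. Qed.

Lemma derive_smooth_mul (V : normedModType R) (f g : V -> R) v p :
  smooth_on setT f -> smooth_on setT g ->
  'D_v (fun p => f p * g p) p = f p * 'D_v g p + g p * 'D_v f p.
Proof.
move=> fs gs; apply: deriveM.
  exact: (smooth_on_derivable fs I).
exact: (smooth_on_derivable gs I).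
Qed.

Lemma derive_smooth_add (V : normedModType R) (f g : V -> R) v p :
  smooth_on setT f -> smooth_on setT g ->
  'D_v (fun p => f p + g p) p = 'D_v f p + 'D_v g p.
Proof.
move=> fs gs; apply: deriveD.
  exact: (smooth_on_derivable fs I).
exact: (smooth_on_derivable gs I).
Qed.

Lemma derive_linear (V W : normedModType R) (L : {linear V -> W}) v p :
  continuous L -> 'D_v L p = L v.
Proof.
move=> cL; rewrite deriveE; last exact: linear_differentiable.
by rewrite diff_lin.
Qed.

Lemma smooth_linear (V : normedModType R) (L : {linear V -> R}) :
  continuous L -> smooth_on setT L.
Proof.
move=> cL; apply: (@smooth_on_coind _ _ _ _
  (fun h => smooth_on setT h \/ h = L)); last by right.
move=> f [fs|->].
  split=> [p _|]; first exact: (smooth_on_continuous fs I).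
  split=> [p v _|v]; first exact: (smooth_on_derivable fs I).
  by left; exact: smooth_on_derive.
split=> [p _|]; first exact: cL.
split=> [p v _|v]; first exact/diff_derivable/linear_differentiable.
left; rewrite (_ : 'D_v L = fun=> L v); first exact: smooth_cst.
by apply/funext => p; exact: derive_linear.
Qed.

End SmoothAlgebra.

(** * Vectors of R^3 and continuity *)

Lemma continuous_pair (T U V : topologicalType) (f : T -> U) (g : T -> V) x :
  {for x, continuous f} -> {for x, continuous g} ->
  {for x, continuous (fun y => (f y, g y))}.
Proof. by move=> cf cg; apply: (@cvg_pair _ _ _ _ (nbhs (f x)) (nbhs (g x))). Qed.

Lemma continuous_mulr (R : realType) (T : topologicalType) (f g : T -> R) :
  continuous f -> continuous g -> continuous (fun s => f s * g s).
Proof. by move=> cf cg s; apply: continuousM; [exact: cf|exact: cg]. Qed.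

Lemma continuous_addr (R : realType) (T : topologicalType) (f g : T -> R) :
  continuous f -> continuous g -> continuous (fun s => f s + g s).
Proof. by move=> cf cg s; apply: continuousD; [exact: cf|exact: cg]. Qed.

Lemma continuous_cst (T T' : topologicalType) (k : T') : continuous (fun _ : T => k).
Proof. by move=> s; exact: cvg_cst. Qed.

Lemma sum_ord2 (V : nmodType) (F : 'I_2 -> V) : \sum_(i < 2) F i = F 0 + F 1.
Proof.
by rewrite !big_ord_recl big_ord0 addr0; congr (_ + F _); exact: val_inj.
Qed.

Lemma invmx2 (F : fieldType) (A : 'M[F]_2) : \det A != 0 ->
  [/\ invmx A 0 0 = A 1 1 / \det A, invmx A 0 1 = - A 0 1 / \det A,
      invmx A 1 0 = - A 1 0 / \det A & invmx A 1 1 = A 0 0 / \det A].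
Proof.
move=> dA; rewrite /invmx unitmxE unitfE dA !mxE /cofactor !det_mx11 !mxE.
have E1 (j : 'I_1) : lift (0 : 'I_2) j = 1 by apply: val_inj; rewrite /= ord1.
have E0 (j : 'I_1) : lift (1 : 'I_2) j = 0 by apply: val_inj; rewrite /= ord1.
rewrite !E0 !E1 /= !(addn0, add0n, addn1) expr0 expr1 sqrrN expr1n.
by split; field.
Qed.

Lemma continuous_dot (R : realType) (T : topologicalType) (f g : T -> 'rV[R]_3) t :
  {for t, continuous f} -> {for t, continuous g} ->
  {for t, continuous (fun s => dot (f s) (g s))}.
Proof.
move=> cf cg.
have H k : {for t, continuous (fun s => f s 0 k * g s 0 k)}.
  have ck (h : T -> 'rV[R]_3) : {for t, continuous h} ->
      {for t, continuous (fun s => h s 0 k)}.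
    move=> ch; apply: (@continuous_comp _ _ _ h (fun v : 'rV[R]_3 => v 0 k)) => //.
    exact: coord_continuous.
  by apply: continuousM; exact: ck.
rewrite /dot (_ : (fun _ => _) = fun s => f s 0 0 * g s 0 0 + f s 0 1 * g s 0 1
   + f s 0 2 * g s 0 2).
  by apply: continuousD; [apply: continuousD|]; exact: H.
by apply/funext => s; rewrite !big_ord_recl big_ord0 addr0 addrA;
  congr (_ * _ + _ * _ + _ * _); congr (_ 0 _); exact: val_inj.
Qed.

Lemma dotE (R : realType) (v w : 'rV[R]_3) :
  dot v w = v 0 0 * w 0 0 + v 0 1 * w 0 1 + v 0 2 * w 0 2.
Proof.
by rewrite /dot !big_ord_recl big_ord0 addr0 addrA;
  congr (_ * _ + _ * _ + _ * _); congr (_ 0 _); exact: val_inj.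
Qed.

Lemma det_mx2 (R : comNzRingType) (A : 'M[R]_2) :
  \det A = A 0 0 * A 1 1 - A 0 1 * A 1 0.
Proof.
rewrite (expand_det_row _ 0) !big_ord_recl big_ord0 addr0 /cofactor !det_mx11 !mxE.
rewrite /= !addn0 expr0 mul1r expr1 mulN1r mulrN.
by congr (_ * A _ _ - A _ _ * A _ _); exact: val_inj.
Qed.

Section Vec3.
Variable R : realType.

Definition vec3 (x y z : R) : 'rV[R]_3 := \row_k [:: x; y; z]`_k.

Lemma vec3E x y z : (vec3 x y z 0 0 = x) * (vec3 x y z 0 1 = y) * (vec3 x y z 0 2 = z).
Proof. by rewrite !mxE. Qed.

Lemma vec3P (v : 'rV[R]_3) : v = vec3 (v 0 0) (v 0 1) (v 0 2).
Proof.
apply/rowP => k; rewrite mxE; case: k => -[|[|[|//]]] i /=; congr (v 0 _); exact: val_inj.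
Qed.

Lemma smooth_on_vec3 (V : normedModType R) (f g h : V -> R) :
  smooth_on setT f -> smooth_on setT g -> smooth_on setT h ->
  smooth_on setT (fun p => vec3 (f p) (g p) (h p)).
Proof.
move=> fs gs hs.
have sF : smooth_on setT (fun p => \row_k (nth f [:: f; g; h] (k : 'I_3) p)).
  apply: (smooth_on_row (f := fun k : 'I_3 => nth f [:: f; g; h] k)).
  case=> -[|[|[|m]]] i; [exact: fs|exact: gs|exact: hs|by exfalso].
congr (smooth_on setT _): sF; apply/funext => p; apply/rowP => k; rewrite !mxE.
by case: k => -[|[|[|//]]] i.
Qed.

Lemma derive_vec3 (V : normedModType R) (f g h : V -> R) p v :
  derivable f p v -> derivable g p v -> derivable h p v ->
  'D_v (fun p => vec3 (f p) (g p) (h p)) p = vec3 ('D_v f p) ('D_v g p) ('D_v h p).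
Proof.
move=> df dg dh.
have -> : (fun p => vec3 (f p) (g p) (h p)) =
    (fun p => \row_k (nth f [:: f; g; h] (k : 'I_3) p)).
  apply/funext => q; apply/rowP => k; rewrite !mxE.
  by case: k => -[|[|[|//]]] i.
rewrite (derive_row (f := fun k : 'I_3 => nth f [:: f; g; h] k)).
  by apply/rowP => k; rewrite !mxE; case: k => -[|[|[|//]]] i.
case=> -[|[|[|m]]] i; [exact: df|exact: dg|exact: dh|by exfalso].
Qed.

Lemma dot_vec3 (a b c x y z : R) :
  dot (vec3 a b c) (vec3 x y z) = a * x + b * y + c * z.
Proof. by rewrite dotE !vec3E. Qed.

End Vec3.

Section DotProduct.
Variable R : realType.
Implicit Types v w : 'rV[R]_3.

Lemma dotZl k v w : dot (k *: v) w = k * dot v w.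
Proof. by rewrite !dotE !mxE; ring. Qed.

Lemma dot_sub_scale k v w : dot (v - k *: w) (v - k *: w) =
  dot v v - 2 * k * dot v w + k ^+ 2 * dot w w.
Proof. by rewrite !dotE !mxE; ring. Qed.

Lemma dot_eq0 v : dot v v = 0 -> v = 0.
Proof.
rewrite dotE => v0; rewrite [v]vec3P.
have -> : v 0 0 = 0 by nra.
have -> : v 0 1 = 0 by nra.
have -> : v 0 2 = 0 by nra.
by apply/rowP => -[[|[|[|k]]] i]; rewrite !mxE.
Qed.

End DotProduct.

Section LinearProjections.
Variable R : realType.

Lemma hproj_is_linear : linear (@hproj R).
Proof. by move=> k v v'; rewrite /hproj /x1 /x2 !mxE. Qed.

HB.instance Definition _ :=
  GRing.isLinear.Build R 'rV[R]_3 (R * R)%type _ (@hproj R) hproj_is_linear.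

Lemma x3_is_linear : linear (@x3 R).
Proof. by move=> k v v'; rewrite /x3 !mxE. Qed.

HB.instance Definition _ :=
  GRing.isLinear.Build R 'rV[R]_3 R _ (@x3 R) x3_is_linear.

Lemma hproj_continuous : continuous (@hproj R).
Proof. by move=> v; apply: continuous_pair; exact: coord_continuous. Qed.

Lemma x3_continuous : continuous (@x3 R).
Proof. exact: coord_continuous. Qed.

End LinearProjections.

(** * Integration on the plane *)

Section PlaneIntegration.
Variable R : realType.
Local Notation plane := (measurableTypeR R * measurableTypeR R)%type.
Local Notation leb := (@lebesgue_measure R).

(** The product sigma-algebra comes from rectangles, so [U] is written as the countable union of the
    open rectangles with rational endpoints that it contains. *)
Lemma open_plane_measurable (U : set (R * R)) :
  open U -> measurable (U : set plane).
Proof.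
move=> oU.
pose rect (q : (rat * rat) * (rat * rat)) : set plane :=
  `]ratr q.1.1, ratr q.1.2[%classic `*` `]ratr q.2.1, ratr q.2.2[%classic.
have dr (x y : R) : x < y -> exists q : rat, x < ratr q < y.
  move=> xy; have [q] := rat_in_itvoo xy; rewrite in_itv/= => ?.
  by exists q.
have -> : U = \bigcup_(q in [set q | rect q `<=` U]) rect q.
  apply/seteqP; split=> [[x y] Uxy|p [q qU rp]]; last exact: qU.
  have : nbhs (x, y) U by exact: open_nbhs_nbhs.
  move=> [[A B] /= [/nbhs_ballP[d /= d0 dA] /nbhs_ballP[e /= e0 eB]] AB].
  have [q1 /andP[q1l q1r]] := dr (x - d) x (ltac:(by rewrite ltrBlDr ltrDl)).
  have [q2 /andP[q2l q2r]] := dr x (x + d) (ltac:(by rewrite ltrDl)).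
  have [q3 /andP[q3l q3r]] := dr (y - e) y (ltac:(by rewrite ltrBlDr ltrDl)).
  have [q4 /andP[q4l q4r]] := dr y (y + e) (ltac:(by rewrite ltrDl)).
  exists ((q1, q2), (q3, q4)) => /=; last first.
    by split; rewrite /= in_itv/=; apply/andP; split.
  move=> [s t] [/=]; rewrite !in_itv/= => /andP[s1 s2] /andP[t1 t2].
  apply: AB; split => /=.
    by apply: dA; rewrite /ball/= ltr_distlC; apply/andP; split; lra.
  by apply: eB; rewrite /ball/= ltr_distlC; apply/andP; split; lra.
rewrite bigcup_mkcond; apply: countable_bigcupT_measurable => // q.
case: ifP => // _; exact: measurableX.
Qed.

Lemma closed_plane_measurable (U : set (R * R)) :
  closed U -> measurable (U : set plane).
Proof.
move=> cU; rewrite -[U]setCK; apply: measurableC; apply: open_plane_measurable.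
exact: closed_openC.
Qed.

Lemma open_continuous_plane_measurable (U : set (R * R)) (f : R * R -> R) :
  open U -> (forall p, U p -> {for p, continuous f}) ->
  measurable_fun (U : set plane) f.
Proof.
move=> oU cf; apply: (measurability _ (RGenOpens.measurableE R)).
move=> _ [_ [a [b ->] <-]]; apply: open_plane_measurable.
rewrite openE => p [Up fp]; apply: filterI; first exact: open_nbhs_nbhs.
by apply: (cf p Up); apply: open_nbhs_nbhs; split=> //; exact: interval_open.
Qed.

Lemma continuous_plane_measurable (f : R * R -> R) :
  continuous f -> measurable_fun [set: plane] f.
Proof.
move=> cf; apply: (@open_continuous_plane_measurable setT) => [|p _].
  exact: openT.
exact: cf.
Qed.

Definition square (B : R) : set (R * R) := `[- B, B]%classic `*` `[- B, B]%classic.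

Lemma measurable_square B : measurable (square B : set plane).
Proof. exact: measurableX. Qed.

Lemma square_measure_lty B : ((leb \x leb)%E (square B) < +oo)%E.
Proof.
rewrite product_measure1E//= lebesgue_measure_itv/=.
by case: ifP => // _; rewrite -?EFinB -?EFinM ?mul0e ltry.
Qed.

Lemma compact_square B : compact (square B).
Proof. by apply: compact_setX; exact: segment_compact. Qed.

Lemma continuous_square_integrable (f : R * R -> R) B :
  continuous f -> (forall p, ~ square B p -> f p = 0) ->
  (leb \x leb)%E.-integrable [set: plane] (EFin \o f).
Proof.
move=> cf f0.
have -> : EFin \o f = (EFin \o f) \_ (square B).
  apply/funext => p; rewrite patchE; case: ifPn => // /negP pB /=.
  by rewrite f0// => Bp; apply: pB; rewrite inE.
apply/(integrable_mkcond _ (measurable_square B)).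
apply: measurable_bounded_integrable.
- exact: measurable_square.
- exact: square_measure_lty.
- by apply: measurable_funTS; exact: continuous_plane_measurable.
- have : compact (f @` square B).
    apply: continuous_compact; last exact: compact_square.
    exact: continuous_subspaceT.
  move=> /compact_bounded; rewrite /bounded_near => H.
  near=> M => x Bx; have : (forall y, (f @` square B) y -> `|y| <= M) by near: M.
  by apply; exists x.
Unshelve. all: by end_near. Qed.

Lemma integral_deriv_compact (F f : R -> R) (B : R) : 0 < B -> continuous f ->
  (forall x : R, is_derive x (1 : R) F (f x)) ->
  (forall x, B <= `|x| -> F x = 0) -> (forall x, B < `|x| -> f x = 0) ->
  (\int[leb]_x (f x)%:E = 0)%E.
Proof.
move=> B0 cf dF F0 f0.
have -> : (\int[leb]_x (f x)%:E)%E = (\int[leb]_(x in `[(- B)%R, B]) (f x)%:E)%E.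
  rewrite [RHS]integral_mkcond; apply: eq_integral => x _.
  rewrite patchE; case: ifPn => //; rewrite notin_setE/= in_itv/= -ler_norml => /negP.
  by rewrite -ltNge => /f0 ->.
have cF : continuous F.
  move=> x; apply: differentiable_continuous; apply/derivable1_diffP.
  by have [] := dF x.
rewrite (continuous_FTC2 (F := F)).
- have FB : F B = 0 by rewrite F0// ler_norm.
  have FNB : F (- B) = 0 by rewrite F0// normrN ler_norm.
  by rewrite FB FNB subee.
- lra.
- exact: continuous_subspaceT.
- split=> [x _||]; first by have [] := dF x.
    exact/cvg_at_right_filter/cF.
  exact/cvg_at_left_filter/cF.
- by move=> x _; rewrite derive1E; have [_ ->] := dF x.
Qed.

Lemma notin_square B p : B < `|p.1| \/ B < `|p.2| -> ~ square B p.
Proof.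
move=> H [/=]; rewrite !in_itv/= -!ler_norml => ? ?.
by case: H; rewrite ltNge => /negP.
Qed.

(** Fubini, integrating first in the variable of differentiation: each inner integral is the
    difference of two boundary values of [F], both zero. *)
Lemma integral_partial1 (F f : R * R -> R) B : 0 < B -> continuous f ->
  (forall p, is_derive p ((1, 0) : R * R) F (f p)) ->
  (forall p, ~ square B p -> F p = 0) -> (forall p, ~ square B p -> f p = 0) ->
  (\int[leb \x leb]_p (f p)%:E = 0)%E.
Proof.
move=> B0 cf dF F0 f0.
rewrite -integral21_prod_meas1; last exact: continuous_square_integrable f0.
rewrite integral0_eq// => y _.
(* [F] is known to vanish only strictly outside the square, whereas the endpoints of the interval
   must be zeros of it: hence [B + 1]. *)
apply: (@integral_deriv_compact (fun x => F (x, y)) _ (B + 1)).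
- lra.
- move=> x; apply: (@continuous_comp _ _ _ (fun x : R => (x, y))); last exact: cf.
  by apply: continuous_pair; [exact: cvg_id|exact: cvg_cst].
- move=> x; have [d e] := dF (x, y).
  have E (h : R) : F (h *: (1 : R) + x, y) - F (x, y) =
      F (h *: ((1, 0) : R * R) + (x, y)) - F (x, y).
    by congr (F _ - _); congr pair; rewrite /= ?scaler0 ?add0r.
  apply: DeriveDef; first exact: (eq_growth_derivable E).
  by rewrite (eq_growth_derive E).
- by move=> x Bx; apply: F0; apply: notin_square; left => /=; lra.
- by move=> x Bx; apply: f0; apply: notin_square; left => /=; lra.
Qed.

Lemma integral_partial2 (F f : R * R -> R) B : 0 < B -> continuous f ->
  (forall p, is_derive p ((0, 1) : R * R) F (f p)) ->
  (forall p, ~ square B p -> F p = 0) -> (forall p, ~ square B p -> f p = 0) ->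
  (\int[leb \x leb]_p (f p)%:E = 0)%E.
Proof.
move=> B0 cf dF F0 f0.
rewrite -integral12_prod_meas1; last exact: continuous_square_integrable f0.
rewrite integral0_eq// => x _.
apply: (@integral_deriv_compact (fun y => F (x, y)) _ (B + 1)).
- lra.
- move=> y; apply: (@continuous_comp _ _ _ (fun y : R => (x, y))); last exact: cf.
  by apply: continuous_pair; [exact: cvg_cst|exact: cvg_id].
- move=> y; have [d e] := dF (x, y).
  have E (h : R) : F (x, h *: (1 : R) + y) - F (x, y) =
      F (h *: ((0, 1) : R * R) + (x, y)) - F (x, y).
    by congr (F _ - _); congr pair; rewrite /= ?scaler0 ?add0r.
  apply: DeriveDef; first exact: (eq_growth_derivable E).
  by rewrite (eq_growth_derive E).
- by move=> y By; apply: F0; apply: notin_square; right => /=; lra.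
- by move=> y By; apply: f0; apply: notin_square; right => /=; lra.
Qed.

Lemma closed_square B : closed (square B).
Proof. by apply: compact_closed; [exact: norm_hausdorff|exact: compact_square]. Qed.

Lemma compact_sub_square (K : set (R * R)) : compact K ->
  exists2 B, 0 < B & K `<=` square B.
Proof.
move=> /compact_bounded[B0 [_ KB]].
have B1 : `|B0| + 1 > B0 by rewrite ltr_pwDr// ler_norm.
exists (`|B0| + 1); first by rewrite ltr_wpDl.
move=> p /(KB _ B1); rewrite /= prod_normE ge_max => /andP[p1 p2].
by split; rewrite /= in_itv/= -ler_norml.
Qed.

End PlaneIntegration.

(* The canonical sigma-finite structure of products only covers
   subprobabilities. *)
Definition plane_measure (R : realType) :
  set (measurableTypeR R * measurableTypeR R) -> \bar R :=
  (@lebesgue_measure R \x @lebesgue_measure R)%E.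

HB.instance Definition _ (R : realType) := Measure.on (@plane_measure R).

Lemma plane_sigma_finite (R : realType) : sigma_finite setT (@plane_measure R).
Proof.
exists (fun n => square (n%:R : R)).
  apply/esym/seteqP; split=> // -[x y] _.
  exists (Num.truncn (Num.max `|x| `|y|)).+1 => //.
  have := truncnS_gt (Num.max `|x| `|y|); rewrite gt_max => /andP[xn yn].
  by split; rewrite /= in_itv/= -ler_norml; exact: ltW.
by move=> n; split; [exact: measurable_square|exact: square_measure_lty].
Qed.

HB.instance Definition _ (R : realType) :=
  Measure_isSigmaFinite.Build _ _ _ (@plane_measure R) (@plane_sigma_finite R).

(** * Integration against a measure given by a density *)

Section Density.
Context d (T : measurableType d) (R : realType).
Variables (nu : {measure set T -> \bar R}) (mu : {sigma_finite_measure set T -> \bar R}).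

(** Restricted to [E], [nu] is finite and absolutely continuous with respect to [mu]. Its
    Radon-Nikodym derivative has the same integrals as [w] over measurable subsets of [E], so the
    two agree almost everywhere on [E], and the change of variables formula applies. *)
Lemma integral_density (E : set T) (w f : T -> \bar R) :
  measurable E -> (nu E < +oo)%E -> measurable_fun E w ->
  (forall A, measurable A -> A `<=` E -> nu A = \int[mu]_(x in A) w x)%E ->
  nu.-integrable E f ->
  (\int[nu]_(x in E) f x = \int[mu]_(x in E) (f x * w x))%E.
Proof.
move=> mE Efin mw nuw fi.
pose nu' := mfrestr mE Efin.
have nu'E A : measurable A -> A `<=` E -> nu' A = nu A.
  by move=> mA AE; rewrite /nu' /mfrestr/= /mrestr setIidl.
have dom : nu' `<< mu.
  apply/null_content_dominatesP => A mA muA.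
  rewrite /nu' /mfrestr/= /mrestr nuw//; last exact: measurableI.
  apply: null_set_integral.
  - exact: measurableI.
  - by apply: measurable_funS mw.
  - by apply: (@subset_measure0 _ _ _ mu _ A) => //; exact: measurableI.
have EE : (\int[nu]_(x in E) f x = \int[nu']_(x in E) f x)%E.
  by apply: eq_measure_integral => A mA AE; apply/esym/nu'E.
have fi' : nu'.-integrable E f.
  have [mf fE] := integrableP _ _ _ fi; apply/integrableP; split => //.
  rewrite (_ : \int[_]_(x in E) _ = \int[nu]_(x in E) `|f x|)%E//.
  by apply: eq_measure_integral => A mA AE; exact: nu'E.
rewrite EE -(Radon_Nikodym_change_of_variables dom mE fi').
have mf := measurable_int _ fi.
have irn := @Radon_Nikodym_integrable _ _ _ (charge_of_finite_measure nu') mu dom.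
have mrn : measurable_fun E (Radon_Nikodym (charge_of_finite_measure nu') mu).
  by apply: measurable_funTS; exact: measurable_int irn.
apply: ae_eq_integral => //; [exact: emeasurable_funM..|].
apply: ae_eqe_mul2l; apply: integral_ae_eq => //.
- exact: integrableS irn.
- move=> A AE mA; rewrite -nuw// -nu'E//.
  by rewrite -(@Radon_Nikodym_integral _ _ _ (charge_of_finite_measure nu') mu _ dom).
Qed.
End Density.

(** The push-forward of [mu] is described by [w] only inside [V]. The vanishing of [G] elsewhere
    confines both integrals to [V], where [integral_density] applies. *)
Lemma integral_pushforward_density d d' (T : measurableType d)
    (T' : measurableType d') (R : realType) (mu : {measure set T -> \bar R})
    (la : {sigma_finite_measure set T' -> \bar R}) (psi : T -> T')
    (V : set T') (w G : T' -> \bar R) :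
  measurable_fun setT psi -> measurable V -> (mu setT < +oo)%E ->
  measurable_fun V w ->
  (forall A, measurable A -> A `<=` V -> mu (psi @^-1` A) = \int[la]_(x in A) w x)%E ->
  measurable_fun setT G -> mu.-integrable setT (G \o psi) ->
  (forall x, ~ V x -> G x = 0%E) ->
  (\int[mu]_x G (psi x) = \int[la]_(x in V) (G x * w x))%E.
Proof.
move=> mpsi mV mufin mw muw mG iG G0.
have mpV : measurable (psi @^-1` V).
  by rewrite -[X in measurable X]setTI; exact: (mpsi measurableT).
unshelve epose (nu := (pushforward mu psi : {measure set T' -> \bar R})).
  exact: mpsi.
have iGV : nu.-integrable V G.
  apply: integrable_pushforward => //.
  exact: integrableS iG.
rewrite -(integral_density (nu := nu) mV _ mw muw iGV).
- rewrite [RHS]integral_mkcond.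
  have -> : G \_ V = G.
    apply/funext => x; rewrite patchE; case: ifPn => //.
    by rewrite notin_setE => /G0.
  by rewrite (integral_pushforward mpsi mG)// preimage_setT.
- apply: (@le_lt_trans _ _ (mu setT)) => //.
  by apply: (@le_measure _ _ _ mu (psi @^-1` V)) => //; rewrite inE.
Qed.

(** * Compact surfaces *)

Section Surface.
Variable R : realType.
Variable M : oriented_surface R.
Local Notation leb := (@lebesgue_measure R).

Lemma area_density_continuous (V : set (R * R)) (X : R * R -> 'rV[R]_3) p :
  smooth_on V X -> V p -> {for p, continuous (area_density X)}.
Proof.
move=> sX Vp.
have cF i j : {for p, continuous (fun q => first_form X q i j)}.
  rewrite (_ : (fun _ => _) = fun q => dot ('D_(e2 R i) X q) ('D_(e2 R j) X q)); last first.
    by apply/funext => q; rewrite mxE.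
  by apply: continuous_dot; apply: smooth_on_continuous Vp; exact: smooth_on_derive.
rewrite /area_density.
apply: (@continuous_comp _ _ _ (fun q => \det (first_form X q)) (@Num.sqrt R));
  last exact: sqrt_continuous.
rewrite (_ : (fun _ => _) = fun q => first_form X q 0 0 * first_form X q 1 1 -
  first_form X q 0 1 * first_form X q 1 0); last first.
  by apply/funext => q; rewrite det_mx2.
by apply: continuousB; apply: continuousM; exact: cF.
Qed.

(** Locally [imm] is [X] composed with the inverse of [phi], and that inverse is continuous because
    [phi] maps relatively open sets to open sets. *)
Lemma imm_continuous : continuous (@imm R M).
Proof.
move=> s; have [V [phi [X [lp [p hVp <-]]]]] := surf_cover s.
move=> N; rewrite /= -(lp_imm lp hVp) => XN.
have Vp : V p by case: hVp.
have cX : {for p, continuous X} by apply: smooth_on_continuous Vp; exact: lp_smooth lp.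
have oU : open (X @^-1` N)° by exact: open_interior.
rewrite nbhsE/=; exists (phi @` ((X @^-1` N)° `&` Defs.half V)).
  split; first exact: lp_openmap lp _ oU.
  exists p => //; split => //; exact: cX.
move=> _ [q [Uq hVq] <-] /=; rewrite -(lp_imm lp hVq).
exact: (interior_subset Uq).
Qed.

(** Local ingredient of the finiteness of the total area, which compactness then yields and on which
    the integrability of continuous functions rests. *)
Lemma area_locally_finite (s : M) :
  exists2 O : set M, open O /\ O s & (area M O < +oo)%E.
Proof.
have [V [phi [X [lp [p hVp <-]]]]] := surf_cover s.
have Vp : V p by case: hVp.
have cW : {for p, continuous (area_density X)}.
  by apply: area_density_continuous Vp; exact: lp_smooth lp.
(* Near [p] the density stays below [C] and the parameters stay in a square, so the area is at most
   [C] times that of the square. *)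
pose C := area_density X p + 1.
pose N := [set q | V q /\ area_density X q < C /\ `|q - p| < 1].
have Np : nbhs p N.
  apply: filterI; first by apply: open_nbhs_nbhs; split => //; exact: lp_open lp.
  apply: filterI.
    by apply: (cvgr_lt _ cW); rewrite /C ltrDl.
  near=> q; rewrite distrC; near: q; exact: cvgr_dist_lt.
pose U := N°.
have UN : U `<=` N by exact: interior_subset.
have oU : open U by exact: open_interior.
exists (phi @` (U `&` Defs.half V)).
  by split; [exact: lp_openmap lp _ oU|exists p].
have UV : U `&` Defs.half V = U `&` [set q | 0 <= q.2].
  apply/seteqP; split=> [q [Uq [Vq q2]]|q [Uq q2]] //.
  by split=> //; split=> //; have [] := UN _ Uq.
have cl : closed [set q : R * R | 0 <= q.2].
  apply: (@closed_comp _ _ snd [set x : R | 0 <= x]); last exact: closed_ge.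
  by move=> x _; exact: cvg_snd.
have mA : measurable (U `&` Defs.half V : set (measurableTypeR R * measurableTypeR R)).
  rewrite UV; apply: measurableI; first exact: open_plane_measurable.
  exact: closed_plane_measurable.
rewrite (area_param lp mA); last by move=> q [].
pose B := `|p| + 1.
have NB : U `<=` square B.
  move=> q /UN[_ [_ qp]].
  have : `|q| <= B.
    rewrite /B -(subrK p q) (le_trans (ler_normD _ _))// addrC lerD2l; exact: ltW.
  rewrite prod_normE/= ge_max => /andP[q1 q2].
  by split; rewrite /= in_itv/= -ler_norml.
apply: (@le_lt_trans _ _ (C%:E * (leb \x leb)%E (U `&` Defs.half V))%E); last first.
  rewrite lte_mul_pinfty//.
    by rewrite lee_fin /C addr_ge0// sqrtr_ge0.
  apply: le_lt_trans (square_measure_lty B).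
  apply: le_measure; rewrite ?inE//; first exact: measurable_square.
  by move=> q [/NB].
rewrite (_ : \int[_]_(x in _) _ = \int[leb \x leb]_(q in U `&` Defs.half V)
    `|(area_density X q)%:E|)%E; last first.
  by apply: eq_integral => q _; rewrite gee0_abs// lee_fin sqrtr_ge0.
apply: integral_le_bound => //.
- apply: measurableT_comp => //.
  apply: (@measurable_funS _ _ _ _ V).
  + by apply: open_plane_measurable; exact: lp_open lp.
  + by move=> q [_ []].
  + apply: open_continuous_plane_measurable; first exact: lp_open lp.
    by move=> q Vq; apply: area_density_continuous Vq; exact: lp_smooth lp.
- by rewrite lee_fin /C addr_ge0// sqrtr_ge0.
- apply: aeW => q [/UN[_ [/ltW qC _]] _].
  by rewrite abse_EFin lee_fin ger0_norm// sqrtr_ge0.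
Unshelve. all: by end_near. Qed.

Lemma area_finite : (area M setT < +oo)%E.
Proof.
have cpt := @surf_compact R M; rewrite compact_cover in cpt.
have H (s : M) : exists O : set M, [/\ open O, O s & (area M O < +oo)%E].
  by have [U [oU Us] aU] := area_locally_finite s; exists U.
pose f s := projT1 (cid (H s)).
have fP s : [/\ open (f s), f s s & (area M (f s) < +oo)%E] := projT2 (cid (H s)).
have [||K _ cov] := cpt M setT f.
- by move=> s _; have [] := fP s.
- by move=> s _; exists s => //; have [] := fP s.
have mf s : measurable (f s : set (borel M)).
  by apply: sub_sigma_algebra; have [] := fP s.
rewrite (_ : setT = \bigcup_(i in [set i | i \in finmap.enum_fset K]) f i); last first.
  by apply/seteqP; split.
rewrite bigcup_fset.
elim: (finmap.enum_fset K) => [|s l IH]; first by rewrite big_nil measure0.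
rewrite big_cons; apply: le_lt_trans.
  apply: measureU2 => //.
  by apply: bigsetU_measurable.
by rewrite lte_add_pinfty//; have [] := fP s.
Qed.

Lemma continuous_surface_measurable (f : M -> R) :
  continuous f -> measurable_fun [set: borel M] (f : borel M -> R).
Proof.
move=> /continuousP cf; apply: (measurability _ (RGenOpens.measurableE R)).
move=> _ [_ [a [b ->] <-]]; rewrite setTI; apply: sub_sigma_algebra.
by apply: cf; exact: interval_open.
Qed.

Lemma continuous_surface_integrable (f : M -> R) :
  continuous f -> (area M).-integrable [set: borel M] (EFin \o f).
Proof.
move=> cf; apply: measurable_bounded_integrable.
- exact: measurableT.
- exact: area_finite.
- exact: continuous_surface_measurable.
- have : compact (f @` [set: M]).
    apply: continuous_compact; last exact: surf_compact.
    exact: continuous_subspaceT.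
  move=> /compact_bounded; rewrite /bounded_near => H.
  near=> B => x _; have : (forall y, (f @` [set: M]) y -> `|y| <= B) by near: B.
  by apply; exists x.
Unshelve. all: by end_near. Qed.

End Surface.

Section EnergyAsIntegral.
Variables (R : realType) (M : oriented_surface R).

Lemma imm_coord_continuous k : continuous (fun s : M => imm s 0 k).
Proof.
move=> s; apply: (@continuous_comp _ _ _ (@imm R M) (fun v : 'rV[R]_3 => v 0 k)).
  exact: imm_continuous.
exact: coord_continuous.
Qed.

Lemma N3_continuous : continuous (@N3 R M).
Proof.
by move=> s; apply: continuous_dot; [exact: gauss_cont|exact: cvg_cst].
Qed.

Lemma N3E (s : M) : N3 s = gauss s 0 2.
Proof. by rewrite /N3 dotE /E3 !mxE/= !mulr0 mulr1 !add0r. Qed.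

Lemma height_continuous : continuous (fun s : M => x3 (imm s) * N3 s).
Proof. exact: continuous_mulr (@imm_coord_continuous 2) (@N3_continuous). Qed.

Lemma weighted_height_continuous :
  continuous (fun s : M => rsq (imm s) * x3 (imm s) * N3 s).
Proof.
have c1 := @imm_coord_continuous 0; have c2 := @imm_coord_continuous 1.
have crsq : continuous (fun s : M => rsq (imm s)).
  exact: continuous_addr (continuous_mulr c1 c1) (continuous_mulr c2 c2).
exact: continuous_mulr (continuous_mulr crsq (@imm_coord_continuous 2)) (@N3_continuous).
Qed.

Definition energy_density (a b : R) (s : M) : R :=
  1 + a * (rsq (imm s) * x3 (imm s) * N3 s) + b * (x3 (imm s) * N3 s).

Lemma energy_density_continuous a b : continuous (energy_density a b).
Proof.
have ca : continuous (fun s : M => a * (rsq (imm s) * x3 (imm s) * N3 s)).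
  by apply: continuous_mulr; [exact: continuous_cst|exact: weighted_height_continuous].
have cb : continuous (fun s : M => b * (x3 (imm s) * N3 s)).
  by apply: continuous_mulr; [exact: continuous_cst|exact: height_continuous].
apply: continuous_addr => //; apply: continuous_addr => //.
exact: continuous_cst.
Qed.

(** Continuous functions being integrable, the three terms merge into one integral; energy and flux
    can then be compared pointwise. *)
Lemma energyE a b : energy a b M = \int[area M]_s energy_density a b s.
Proof.
have ic (f : M -> R) : continuous f -> (area M).-integrable [set: borel M] (EFin \o f).
  exact: continuous_surface_integrable.
have ca : continuous (fun s : M => a * (rsq (imm s) * x3 (imm s) * N3 s)).
  by apply: continuous_mulr; [exact: continuous_cst|exact: weighted_height_continuous].
have cb : continuous (fun s : M => b * (x3 (imm s) * N3 s)).
  by apply: continuous_mulr; [exact: continuous_cst|exact: height_continuous].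
have i1 : (area M).-integrable [set: borel M] (EFin \o (fun=> 1)).
  by apply: ic; exact: continuous_cst.
have i2 := ic _ (@weighted_height_continuous).
have i3 := ic _ (@height_continuous).
have i2' := ic _ ca; have i3' := ic _ cb.
rewrite /energy -(RintegralZl a measurableT i2) -(RintegralZl b measurableT i3).
rewrite -(RintegralD measurableT i1 i2') -(RintegralD measurableT _ i3')//.
by apply: ic; apply: continuous_addr => //; exact: continuous_cst.
Qed.

End EnergyAsIntegral.

(** * Geometry of a graph *)

(* Sealed, so that the two partial derivatives are never compared by unfolding
   them to limits. *)
HB.lock Definition partial1 (R : realType) (f : R * R -> R) : R * R -> R :=
  'D_((1, 0) : R * R) f.
HB.lock Definition partial2 (R : realType) (f : R * R -> R) : R * R -> R :=
  'D_((0, 1) : R * R) f.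

Section Graph.
Variables (R : realType) (U : R * R -> R).
Hypothesis sU : smooth_on setT U.

Local Notation d1 := (@partial1 R).
Local Notation d2 := (@partial2 R).

(* With W = sqrt (1 + |DU|^2): [slope_inv] is 1 / W, [tilt1] and [tilt2] are the
   components of DU / W, and [graph_curv] is div (DU / W), twice the mean
   curvature for the upward normal. *)
Definition slope_inv (p : R * R) : R := (Num.sqrt (1 + d1 U p ^+ 2 + d2 U p ^+ 2))^-1.
Local Notation w := slope_inv.
Definition tilt1 (p : R * R) : R := d1 U p * w p.
Definition tilt2 (p : R * R) : R := d2 U p * w p.
Definition graph_curv (p : R * R) : R := d1 tilt1 p + d2 tilt2 p.

Lemma partial1E f p : 'D_((1, 0) : R * R) f p = d1 f p.
Proof. by rewrite partial1.unlock. Qed.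
Lemma partial2E f p : 'D_((0, 1) : R * R) f p = d2 f p.
Proof. by rewrite partial2.unlock. Qed.

Lemma smooth_partial1 f : smooth_on setT f -> smooth_on setT (d1 f).
Proof. by rewrite partial1.unlock; exact: smooth_on_derive. Qed.
Lemma smooth_partial2 f : smooth_on setT f -> smooth_on setT (d2 f).
Proof. by rewrite partial2.unlock; exact: smooth_on_derive. Qed.

Lemma slope_gt0 p : 0 < 1 + d1 U p ^+ 2 + d2 U p ^+ 2.
Proof. by rewrite -addrA ltr_pwDl// addr_ge0// sqr_ge0. Qed.

Lemma slope_inv_gt0 p : 0 < w p.
Proof. by rewrite invr_gt0 sqrtr_gt0 slope_gt0. Qed.

Lemma slope_inv_sqr p : w p ^+ 2 * (1 + d1 U p ^+ 2 + d2 U p ^+ 2) = 1.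
Proof.
rewrite exprVn sqr_sqrtr; last exact/ltW/slope_gt0.
by rewrite mulVf// gt_eqF// slope_gt0.
Qed.

Let s1U := smooth_partial1 sU.
Let s2U := smooth_partial2 sU.

Lemma smooth_slope_inv : smooth_on setT w.
Proof.
have H : smooth_expr (fun p => 1 + d1 U p * d1 U p + d2 U p * d2 U p).
  apply: smooth_expr_add; last by apply: smooth_expr_mul; exact: smooth_expr_base.
  apply: smooth_expr_add; first exact: smooth_expr_cst.
  by apply: smooth_expr_mul; exact: smooth_expr_base.
have -> : w = fun p => (Num.sqrt (1 + d1 U p * d1 U p + d2 U p * d2 U p))^-1.
  by apply/funext => p; rewrite /slope_inv !expr2.
apply/smooth_expr_smooth/smooth_expr_rsqrt => // p.
by have := slope_gt0 p; rewrite !expr2.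
Qed.

Lemma smooth_tilt1 : smooth_on setT tilt1.
Proof. exact: smooth_mul s1U smooth_slope_inv. Qed.
Lemma smooth_tilt2 : smooth_on setT tilt2.
Proof. exact: smooth_mul s2U smooth_slope_inv. Qed.
Lemma smooth_graph_curv : smooth_on setT graph_curv.
Proof.
exact: smooth_add (smooth_partial1 smooth_tilt1) (smooth_partial2 smooth_tilt2).
Qed.

(** Obtained by differentiating the polynomial relation w^2 (1 + |DU|^2) = 1 rather than the square
    root itself. *)
Lemma derive_slope_inv v p :
  'D_v w p = - w p ^+ 3 * (d1 U p * 'D_v (d1 U) p + d2 U p * 'D_v (d2 U) p).
Proof.
have sw := smooth_slope_inv.
have sww := smooth_mul sw sw.
have s11 := smooth_mul s1U s1U; have s22 := smooth_mul s2U s2U.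
have s12 := smooth_add s11 s22.
have s112 := smooth_add (smooth_cst 1) s12.
have E : (fun q => w q * w q * (1 + (d1 U q * d1 U q + d2 U q * d2 U q))) = fun=> 1.
  apply/funext => q; have := slope_inv_sqr q.
  by move: (w q) (d1 U q) (d2 U q) => W a b H; rewrite -[RHS]H; ring.
have d0 : 'D_v (fun _ : R * R => 1 : R) p = 0 by exact: derive_cst.
have := derive_smooth_mul v p sww s112; rewrite E d0.
rewrite (derive_smooth_add v p (smooth_cst 1) s12) (derive_smooth_add v p s11 s22).
rewrite (derive_smooth_mul v p sw sw) (derive_smooth_mul v p s1U s1U).
rewrite (derive_smooth_mul v p s2U s2U) d0 add0r.
have := slope_inv_sqr p.
move: (w p) (d1 U p) (d2 U p) ('D_v w p) => W a b x.
move: ('D_v (d1 U) p) ('D_v (d2 U) p) => A B W1 H.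
(* The right side is W / 2 times the differentiated relation plus x times the relation itself; both
   contributions are zero. *)
have : x + W ^+ 3 * (a * A + b * B) =
    W / 2 * (W * W * (a * A + a * A + (b * B + b * B)) +
      (1 + (a * a + b * b)) * (W * x + W * x)) +
    x * (1 - W ^+ 2 * (1 + a ^+ 2 + b ^+ 2)) by field.
rewrite -H W1 subrr !mulr0 addr0 => /eqP.
by rewrite addr_eq0 mulNr => /eqP.
Qed.

Variable c : R * R.
(* The translation by [c] brings the parameter domain into the upper half-plane. *)
Definition graph_map (p : R * R) : 'rV[R]_3 := vec3 (p.1 - c.1) (p.2 - c.2) (U p).
Definition graph_normal (p : R * R) : 'rV[R]_3 := vec3 (- tilt1 p) (- tilt2 p) (w p).

Let cfst : continuous (fst : R * R -> R). Proof. by move=> q; exact: cvg_fst. Qed.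
Let csnd : continuous (snd : R * R -> R). Proof. by move=> q; exact: cvg_snd. Qed.

Lemma smooth_fst : smooth_on setT (fst : R * R -> R).
Proof. exact: (smooth_linear (L := (fst : {linear (R * R)%type -> R}))). Qed.

Lemma smooth_snd : smooth_on setT (snd : R * R -> R).
Proof. exact: (smooth_linear (L := (snd : {linear (R * R)%type -> R}))). Qed.

Lemma derive_fst v p : 'D_v (fst : R * R -> R) p = v.1.
Proof. exact: (derive_linear (L := (fst : {linear (R * R)%type -> R}))). Qed.

Lemma derive_snd v p : 'D_v (snd : R * R -> R) p = v.2.
Proof. exact: (derive_linear (L := (snd : {linear (R * R)%type -> R}))). Qed.

Lemma smooth_graph_map : smooth_on setT graph_map.
Proof.
have s1 := smooth_fst; have s2 := smooth_snd.
exact: (smooth_on_vec3 (smooth_add s1 (smooth_cst (- c.1)))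
  (smooth_add s2 (smooth_cst (- c.2))) sU).
Qed.

Lemma derive_graph_map v p : 'D_v graph_map p = vec3 v.1 v.2 ('D_v U p).
Proof.
have s1 := smooth_fst; have s2 := smooth_snd.
have s1' := smooth_add s1 (smooth_cst (- c.1)).
have s2' := smooth_add s2 (smooth_cst (- c.2)).
have d0 k : 'D_v (fun _ : R * R => k : R) p = 0 by exact: derive_cst.
rewrite /graph_map derive_vec3.
- rewrite (derive_smooth_add v p s1 (smooth_cst _)) (derive_smooth_add v p s2 (smooth_cst _)).
  by rewrite !d0 !addr0 !(derive_fst, derive_snd).
- exact: smooth_on_derivable s1' I.
- exact: smooth_on_derivable s2' I.
- exact: smooth_on_derivable sU I.
Qed.

Lemma derive2_graph_map v v' p :
  'D_v ('D_v' graph_map) p = vec3 0 0 ('D_v ('D_v' U) p).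
Proof.
have -> : 'D_v' graph_map = fun q => vec3 v'.1 v'.2 ('D_v' U q).
  by apply/funext => q; exact: derive_graph_map.
have d0 k : 'D_v (fun _ : R * R => k : R) p = 0 by exact: derive_cst.
rewrite (derive_vec3 (f := fun=> v'.1) (g := fun=> v'.2) (h := 'D_v' U)).
- by rewrite !d0.
- exact: (smooth_on_derivable (smooth_cst _) I).
- exact: (smooth_on_derivable (smooth_cst _) I).
- exact: (smooth_on_derivable (smooth_on_derive _ sU) I).
Qed.

Lemma derive_tilt1 v p : 'D_v tilt1 p = w p ^+ 3 *
  ((1 + d2 U p ^+ 2) * 'D_v (d1 U) p - d1 U p * d2 U p * 'D_v (d2 U) p).
Proof.
rewrite /tilt1 (derive_smooth_mul v p s1U smooth_slope_inv) derive_slope_inv.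
have := slope_inv_sqr p.
move: (w p) (d1 U p) (d2 U p) ('D_v (d1 U) p) ('D_v (d2 U) p) => W a b A B W1.
(* Inserting w^2 (1 + |DU|^2) = 1 gives both terms the common factor w^3, after which the claim is
   polynomial. *)
have -> : W * A = W * (W ^+ 2 * (1 + a ^+ 2 + b ^+ 2)) * A by rewrite W1 mulr1.
by ring.
Qed.

Lemma derive_tilt2 v p : 'D_v tilt2 p = w p ^+ 3 *
  ((1 + d1 U p ^+ 2) * 'D_v (d2 U) p - d1 U p * d2 U p * 'D_v (d1 U) p).
Proof.
rewrite /tilt2 (derive_smooth_mul v p s2U smooth_slope_inv) derive_slope_inv.
have := slope_inv_sqr p.
move: (w p) (d1 U p) (d2 U p) ('D_v (d1 U) p) ('D_v (d2 U) p) => W a b A B W1.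
have -> : W * B = W * (W ^+ 2 * (1 + a ^+ 2 + b ^+ 2)) * B by rewrite W1 mulr1.
by ring.
Qed.

Lemma partial_tilt p (u1 := d1 U p) (u2 := d2 U p) :
  (d1 tilt1 p = w p ^+ 3 * ((1 + u2 ^+ 2) * d1 (d1 U) p - u1 * u2 * d1 (d2 U) p)) *
  (d2 tilt1 p = w p ^+ 3 * ((1 + u2 ^+ 2) * d2 (d1 U) p - u1 * u2 * d2 (d2 U) p)) *
  (d1 tilt2 p = w p ^+ 3 * ((1 + u1 ^+ 2) * d1 (d2 U) p - u1 * u2 * d1 (d1 U) p)) *
  (d2 tilt2 p = w p ^+ 3 * ((1 + u1 ^+ 2) * d2 (d2 U) p - u1 * u2 * d2 (d1 U) p)).
Proof.
by rewrite -(partial1E tilt1) -(partial1E tilt2) -(partial2E tilt1) -(partial2E tilt2)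
  !derive_tilt1 !derive_tilt2 !partial1E !partial2E.
Qed.

Let e20 : e2 R 0 = (1, 0). Proof. by []. Qed.
Let e21 : e2 R 1 = (0, 1). Proof. by []. Qed.
Let D20 f p : 'D_(e2 R 0) f p = d1 f p. Proof. by rewrite e20 partial1E. Qed.
Let D21 f p : 'D_(e2 R 1) f p = d2 f p. Proof. by rewrite e21 partial2E. Qed.
Let D20f f : 'D_(e2 R 0) f = d1 f. Proof. by apply/funext => p; exact: D20. Qed.
Let D21f f : 'D_(e2 R 1) f = d2 f. Proof. by apply/funext => p; exact: D21. Qed.

Lemma first_form_graph p (G := first_form graph_map p) :
  [/\ G 0 0 = 1 + d1 U p ^+ 2, G 0 1 = d1 U p * d2 U p,
      G 1 0 = d1 U p * d2 U p & G 1 1 = 1 + d2 U p ^+ 2].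
Proof.
have E i j : G i j = dot (vec3 (e2 R i).1 (e2 R i).2 ('D_(e2 R i) U p))
    (vec3 (e2 R j).1 (e2 R j).2 ('D_(e2 R j) U p)).
  by rewrite /G mxE (derive_graph_map (e2 R i)) (derive_graph_map (e2 R j)).
rewrite (E 0 0) (E 0 1) (E 1 0) (E 1 1) D20 D21 e20 e21 /= {E}.
by move: (d1 U p) (d2 U p) => a b; split; rewrite dot_vec3; ring.
Qed.

Lemma det_first_form_graph p :
  \det (first_form graph_map p) = 1 + d1 U p ^+ 2 + d2 U p ^+ 2.
Proof.
rewrite det_mx2; have [-> -> -> ->] := first_form_graph p.
by move: (d1 U p) (d2 U p) => a b; ring.
Qed.

Lemma area_density_graph p : area_density graph_map p = (w p)^-1.
Proof. by rewrite /area_density det_first_form_graph /slope_inv invrK. Qed.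

Lemma inv_first_form_graph p (G := invmx (first_form graph_map p)) :
  [/\ G 0 0 = (1 + d2 U p ^+ 2) * w p ^+ 2, G 0 1 = - (d1 U p * d2 U p) * w p ^+ 2,
      G 1 0 = - (d1 U p * d2 U p) * w p ^+ 2 & G 1 1 = (1 + d1 U p ^+ 2) * w p ^+ 2].
Proof.
have wE : (1 + d1 U p ^+ 2 + d2 U p ^+ 2)^-1 = w p ^+ 2.
  apply: (mulIf (lt0r_neq0 (slope_gt0 p))).
  by rewrite slope_inv_sqr mulVf// lt0r_neq0// slope_gt0.
have d0 : \det (first_form graph_map p) != 0.
  by rewrite det_first_form_graph lt0r_neq0// slope_gt0.
rewrite /G; have [-> -> -> ->] := invmx2 d0.
by have [-> -> -> ->] := first_form_graph p; rewrite det_first_form_graph wE.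
Qed.

Lemma second_form_graph eps p i j :
  second_form graph_map (eps *: graph_normal p) p i j =
  eps * w p * 'D_(e2 R i) ('D_(e2 R j) U) p.
Proof.
rewrite mxE derive2_graph_map /graph_normal.
move: (derive _ _ _) => h; rewrite dotE !mxE /=; ring.
Qed.

(** Since g^-1 = I - w^2 DU DU^T and h = eps w D^2 U, the shape operator g^-1 h is eps times the
    Jacobian matrix of ([tilt1], [tilt2]); its trace is eps times their divergence. *)
Lemma mean_curv_graph eps p :
  2 * mean_curv graph_map (eps *: graph_normal p) p = eps * graph_curv p.
Proof.
rewrite /mean_curv mulrC mulfVK ?pnatr_eq0// /mxtrace sum_ord2 !mxE !sum_ord2.
rewrite !second_form_graph D20f D21f !(D20, D21).
have [-> -> -> ->] := inv_first_form_graph p.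
rewrite /graph_curv !partial_tilt.
move: (w p) (d1 U p) (d2 U p) (d1 (d1 U) p) (d1 (d2 U) p) (d2 (d1 U) p) (d2 (d2 U) p).
by move=> W a b h00 h01 h10 h11; ring.
Qed.

(** Trace of the square of that same Jacobian matrix; the orientation sign disappears on
    squaring. *)
Lemma sff_sqnorm_graph eps p : eps ^+ 2 = 1 ->
  sff_sqnorm graph_map (eps *: graph_normal p) p =
  d1 tilt1 p ^+ 2 + 2 * d1 tilt2 p * d2 tilt1 p + d2 tilt2 p ^+ 2.
Proof.
move=> eps1.
rewrite /sff_sqnorm /shape_op /mxtrace sum_ord2 !mxE !sum_ord2 !mxE !sum_ord2.
rewrite !second_form_graph D20f D21f !(D20, D21).
have [-> -> -> ->] := inv_first_form_graph p.
rewrite !partial_tilt.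
move: (w p) (d1 U p) (d2 U p) (d1 (d1 U) p) (d1 (d2 U) p) (d2 (d1 U) p) (d2 (d2 U) p).
move=> W a b h00 h01 h10 h11.
rewrite -[RHS]mul1r -[X in _ = X * _]eps1; ring.
Qed.

End Graph.

(** * The Jacobi operator of a graph *)

Section Partials.
Variable R : realType.
Implicit Types f g : R * R -> R.
Local Notation d1 := (@partial1 R).
Local Notation d2 := (@partial2 R).

Lemma partial1_mul f g p : smooth_on setT f -> smooth_on setT g ->
  d1 (fun q => f q * g q) p = f p * d1 g p + g p * d1 f p.
Proof. by move=> fs gs; rewrite -!partial1E; exact: derive_smooth_mul. Qed.

Lemma partial2_mul f g p : smooth_on setT f -> smooth_on setT g ->
  d2 (fun q => f q * g q) p = f p * d2 g p + g p * d2 f p.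
Proof. by move=> fs gs; rewrite -!partial2E; exact: derive_smooth_mul. Qed.

Lemma partial1_add f g p : smooth_on setT f -> smooth_on setT g ->
  d1 (fun q => f q + g q) p = d1 f p + d1 g p.
Proof. by move=> fs gs; rewrite -!partial1E; exact: derive_smooth_add. Qed.

Lemma partial2_add f g p : smooth_on setT f -> smooth_on setT g ->
  d2 (fun q => f q + g q) p = d2 f p + d2 g p.
Proof. by move=> fs gs; rewrite -!partial2E; exact: derive_smooth_add. Qed.

Lemma partial_comm f p : smooth_on setT f -> d1 (d2 f) p = d2 (d1 f) p.
Proof.
by move=> fs; rewrite partial1.unlock partial2.unlock; exact: derive_comm.
Qed.

End Partials.

Section Jacobi.
Variables (R : realType) (U F : R * R -> R).
Hypotheses (sU : smooth_on setT U) (sF : smooth_on setT F).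
Local Notation d1 := (@partial1 R).
Local Notation d2 := (@partial2 R).
Local Notation w := (slope_inv U).
Local Notation n1 := (tilt1 U).
Local Notation n2 := (tilt2 U).
Local Notation Q := (graph_curv U).

Let u1s := smooth_partial1 sU.
Let u2s := smooth_partial2 sU.
Let f1s := smooth_partial1 sF.
Let f2s := smooth_partial2 sF.
Let ws := smooth_slope_inv sU.
Let n1s := smooth_tilt1 sU.
Let n2s := smooth_tilt2 sU.

(* [slope] is W, [flow]_i = sqrt (det g) g^ij d_j F, and
   [drift]_i = n_k d_k n_i = - sqrt (det g) g^ij d_j (1 / W) for n = DU / W. *)
Definition slope p := (1 + (d1 U p * d1 U p + d2 U p * d2 U p)) * w p.
Definition flow1 p := (1 + d2 U p * d2 U p) * w p * d1 F p +
  (- 1 * (d1 U p * d2 U p) * w p) * d2 F p.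
Definition flow2 p := (- 1 * (d1 U p * d2 U p) * w p) * d1 F p +
  (1 + d1 U p * d1 U p) * w p * d2 F p.
Definition drift1 p := n1 p * d1 n1 p + n2 p * d2 n1 p.
Definition drift2 p := n1 p * d1 n2 p + n2 p * d2 n2 p.
Definition weight p := slope p * (F p * F p).
(** With A = sqrt (det g) g^ij, the pair ([field1], [field2]) is F A (DF + F DW / W): the vector
    field of Picone's identity for F against the positive solution 1 / W. The quotient F^2 / (1 / W)
    appears as the product [weight]. *)
Definition field1 p := F p * flow1 p + weight p * drift1 p.
Definition field2 p := F p * flow2 p + weight p * drift2 p.
(** The part of the divergence of the field in which no derivative falls on [flow] or [drift]. *)
Definition dissipation p := d1 F p * flow1 p + d2 F p * flow2 p +
  d1 weight p * drift1 p + d2 weight p * drift2 p.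

Let u11s := smooth_mul u1s u1s.
Let u12s := smooth_mul u1s u2s.
Let u22s := smooth_mul u2s u2s.
Let grads := smooth_add u11s u22s.
Let one_grads := smooth_add (smooth_cst 1) grads.

Lemma smooth_slope : smooth_on setT slope.
Proof. exact: smooth_mul one_grads ws. Qed.

Let a11s := smooth_mul (smooth_add (smooth_cst 1) u22s) ws.
Let a22s := smooth_mul (smooth_add (smooth_cst 1) u11s) ws.
Let a12s := smooth_mul (smooth_mul (smooth_cst (- 1)) u12s) ws.

Lemma smooth_flow1 : smooth_on setT flow1.
Proof. exact: smooth_add (smooth_mul a11s f1s) (smooth_mul a12s f2s). Qed.

Lemma smooth_flow2 : smooth_on setT flow2.
Proof. exact: smooth_add (smooth_mul a12s f1s) (smooth_mul a22s f2s). Qed.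

Lemma smooth_drift1 : smooth_on setT drift1.
Proof.
exact: smooth_add (smooth_mul n1s (smooth_partial1 n1s)) (smooth_mul n2s (smooth_partial2 n1s)).
Qed.

Lemma smooth_drift2 : smooth_on setT drift2.
Proof.
exact: smooth_add (smooth_mul n1s (smooth_partial1 n2s)) (smooth_mul n2s (smooth_partial2 n2s)).
Qed.

Let ffs := smooth_mul sF sF.

Lemma smooth_weight : smooth_on setT weight.
Proof. exact: smooth_mul smooth_slope ffs. Qed.

Lemma smooth_field1 : smooth_on setT field1.
Proof.
exact: smooth_add (smooth_mul sF smooth_flow1) (smooth_mul smooth_weight smooth_drift1).
Qed.

Lemma smooth_field2 : smooth_on setT field2.
Proof.
exact: smooth_add (smooth_mul sF smooth_flow2) (smooth_mul smooth_weight smooth_drift2).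
Qed.

Lemma smooth_dissipation : smooth_on setT dissipation.
Proof.
have s1 := smooth_mul f1s smooth_flow1; have s2 := smooth_mul f2s smooth_flow2.
have s3 := smooth_mul (smooth_partial1 smooth_weight) smooth_drift1.
have s4 := smooth_mul (smooth_partial2 smooth_weight) smooth_drift2.
exact: smooth_add (smooth_add (smooth_add s1 s2) s3) s4.
Qed.

Lemma slope_mul p : slope p * w p = 1.
Proof.
rewrite -(slope_inv_sqr U p) /slope.
by move: (w p) (d1 U p) (d2 U p) => W a b; ring.
Qed.

Lemma partial1_slope_inv p :
  d1 w p = - w p ^+ 3 * (d1 U p * d1 (d1 U) p + d2 U p * d1 (d2 U) p).
Proof. by rewrite -partial1E (derive_slope_inv sU (1, 0)) !partial1E. Qed.

Lemma partial2_slope_inv p :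
  d2 w p = - w p ^+ 3 * (d1 U p * d2 (d1 U) p + d2 U p * d2 (d2 U) p).
Proof. by rewrite -partial2E (derive_slope_inv sU (0, 1)) !partial2E. Qed.

Lemma partial1_slope p :
  d1 slope p = w p * (d1 U p * d1 (d1 U) p + d2 U p * d1 (d2 U) p).
Proof.
have d0 : d1 (fun=> 1) p = 0 by rewrite -partial1E; exact: derive_cst.
rewrite /slope (partial1_mul p one_grads ws) (partial1_add p (smooth_cst 1) grads).
rewrite (partial1_add p u11s u22s) (partial1_mul p u1s u1s) (partial1_mul p u2s u2s).
rewrite partial1_slope_inv d0; have := slope_inv_sqr U p.
move: (w p) (d1 U p) (d2 U p) (d1 (d1 U) p) (d1 (d2 U) p) => W a b A B W1.
transitivity (W * (2 - W ^+ 2 * (1 + a ^+ 2 + b ^+ 2)) * (a * A + b * B)); first by ring.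
by rewrite W1; ring.
Qed.

Lemma partial2_slope p :
  d2 slope p = w p * (d1 U p * d2 (d1 U) p + d2 U p * d2 (d2 U) p).
Proof.
have d0 : d2 (fun=> 1) p = 0 by rewrite -partial2E; exact: derive_cst.
rewrite /slope (partial2_mul p one_grads ws) (partial2_add p (smooth_cst 1) grads).
rewrite (partial2_add p u11s u22s) (partial2_mul p u1s u1s) (partial2_mul p u2s u2s).
rewrite partial2_slope_inv d0; have := slope_inv_sqr U p.
move: (w p) (d1 U p) (d2 U p) (d2 (d1 U) p) (d2 (d2 U) p) => W a b A B W1.
transitivity (W * (2 - W ^+ 2 * (1 + a ^+ 2 + b ^+ 2)) * (a * A + b * B)); first by ring.
by rewrite W1; ring.
Qed.

(* It is the form sqrt (det g) g^ij at (x1, x2) = DF + F DW / W. *)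
Lemma dissipation_ge0 p : 0 <= dissipation p.
Proof.
have Ew1 := partial1_mul p smooth_slope ffs; have Ew2 := partial2_mul p smooth_slope ffs.
have E1 := partial1_mul p sF sF; have E2 := partial2_mul p sF sF.
rewrite /dissipation /weight Ew1 Ew2 E1 E2 partial1_slope partial2_slope.
rewrite /drift1 /drift2 !(partial_tilt sU) /flow1 /flow2 /tilt1 /tilt2.
rewrite (partial_comm p sU).
have := slope_mul p; have := slope_inv_sqr U p; have := slope_inv_gt0 U p.
move: (w p) (slope p) (d1 U p) (d2 U p) (F p) (d1 F p) (d2 F p).
move: (d1 (d1 U) p) (d2 (d1 U) p) (d2 (d2 U) p) => h11 h12 h22.
move=> W S a b f f1 f2 W0 W1 SW.
pose x1 := f1 + f * W ^+ 2 * (a * h11 + b * h12).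
pose x2 := f2 + f * W ^+ 2 * (a * h12 + b * h22).
rewrite (_ : _ + _ = W * (x1 ^+ 2 + x2 ^+ 2 + (b * x1 - a * x2) ^+ 2)).
  by rewrite mulr_ge0 ?addr_ge0 ?sqr_ge0 ?ltW.
pose k1 := a * h11 + b * h12; pose k2 := a * h12 + b * h22.
pose M1 := (1 + b * b) * k1 - a * b * k2.
pose M2 := (1 + a * a) * k2 - a * b * k1.
have -> : W * (x1 ^+ 2 + x2 ^+ 2 + (b * x1 - a * x2) ^+ 2) =
  W * (f1 ^+ 2 + f2 ^+ 2 + (b * f1 - a * f2) ^+ 2) +
  2 * (1 * (W ^+ 3 * f * (f1 * M1 + f2 * M2))) + W ^+ 5 * f ^+ 2 * (k1 * M1 + k2 * M2).
  by rewrite /x1 /x2 /M1 /M2 /k1 /k2; ring.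
(* The cross term of the dissipation still carries the factor [slope], while the square is written
   with [w] alone; the factor 1 set aside above is the place where [slope * w] is put back. *)
rewrite -[X in X * (W ^+ 3 * f * _)]SW /M1 /M2 /k1 /k2.
by ring.
Qed.

(* The d_k n_i are the entries of the shape operator, so this is the Jacobi
   equation of 1 / W. *)
Lemma divergence_drift p : d1 drift1 p + d2 drift2 p =
  d1 n1 p ^+ 2 + 2 * d1 n2 p * d2 n1 p + d2 n2 p ^+ 2 +
  (n1 p * d1 Q p + n2 p * d2 Q p).
Proof.
have s11 := smooth_partial1 n1s; have s21 := smooth_partial2 n1s.
have s12 := smooth_partial1 n2s; have s22 := smooth_partial2 n2s.
rewrite /drift1 /drift2 /graph_curv.
rewrite (partial1_add p (smooth_mul n1s s11) (smooth_mul n2s s21)).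
rewrite (partial2_add p (smooth_mul n1s s12) (smooth_mul n2s s22)).
rewrite (partial1_mul p n1s s11) (partial1_mul p n2s s21).
rewrite (partial2_mul p n1s s12) (partial2_mul p n2s s22).
rewrite (partial1_add p s11 s22) (partial2_add p s11 s22).
rewrite (partial_comm p n1s) (partial_comm p n2s).
move: (n1 p) (n2 p) (d1 n1 p) (d1 n2 p) (d2 n1 p) (d2 n2 p).
move: (d1 (d1 n1) p) (d2 (d1 n1) p) (d2 (d1 n2) p) (d2 (d2 n2) p).
by move=> *; ring.
Qed.

Lemma divergence_field p : d1 field1 p + d2 field2 p - dissipation p =
  F p * (d1 flow1 p + d2 flow2 p) + weight p * (d1 drift1 p + d2 drift2 p).
Proof.
have sf1 := smooth_flow1; have sf2 := smooth_flow2; have sw := smooth_weight.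
have sd1 := smooth_drift1; have sd2 := smooth_drift2.
rewrite /field1 /field2 /dissipation.
rewrite (partial1_add p (smooth_mul sF sf1) (smooth_mul sw sd1)).
rewrite (partial2_add p (smooth_mul sF sf2) (smooth_mul sw sd2)).
rewrite (partial1_mul p sF sf1) (partial1_mul p sw sd1).
rewrite (partial2_mul p sF sf2) (partial2_mul p sw sd2).
by ring.
Qed.

Lemma local_laplacian_graph c p :
  local_laplacian (graph_map U c) F p = w p * (d1 flow1 p + d2 flow2 p).
Proof.
rewrite /local_laplacian (area_density_graph sU) invrK sum_ord2.
have e20 : e2 R 0 = (1, 0) by [].
have e21 : e2 R 1 = (0, 1) by [].
congr (_ * (_ + _)).
  rewrite e20 partial1E; congr (d1 _ p); apply/funext => q.
  rewrite sum_ord2 e20 e21 partial1E partial2E (area_density_graph sU).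
  have [-> -> _ _] := inv_first_form_graph sU c q.
  have := slope_inv_gt0 U q; rewrite /flow1.
  move: (w q) (d1 U q) (d2 U q) (d1 F q) (d2 F q) => W a b x y W0.
  by field; exact: lt0r_neq0.
rewrite e21 partial2E; congr (d2 _ p); apply/funext => q.
rewrite sum_ord2 e20 e21 partial1E partial2E (area_density_graph sU).
have [_ _ -> ->] := inv_first_form_graph sU c q.
have := slope_inv_gt0 U q; rewrite /flow2.
move: (w q) (d1 U q) (d2 U q) (d1 F q) (d2 F q) => W a b x y W0.
by field; exact: lt0r_neq0.
Qed.

(** The Laplacian is [w] times the divergence of [flow], and the potential is the divergence of
    [drift]; since [w * weight] is F^2, both terms come from the divergence of the field. The factor
    [w] is later cancelled by the area density. *)
Lemma jacobi_identity c eps p : eps ^+ 2 = 1 ->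
  F p * (local_laplacian (graph_map U c) F p +
    (sff_sqnorm (graph_map U c) (eps *: graph_normal U p) p +
     (n1 p * d1 Q p + n2 p * d2 Q p)) * F p) =
  w p * (d1 field1 p + d2 field2 p - dissipation p).
Proof.
move=> eps1; rewrite (sff_sqnorm_graph sU c p eps1) divergence_field.
rewrite local_laplacian_graph divergence_drift /weight.
have := slope_mul p; move: (slope p) (w p) => S W SW.
set A := d1 flow1 p + _; set B := _ + (n1 p * _ + _).
transitivity (F p * (W * A) + 1 * F p ^+ 2 * B); first by ring.
by rewrite -SW; ring.
Qed.

End Jacobi.

(** * Compact supports, and the integrated Jacobi inequality *)

Section Support.
Variables (R : realType) (K : set (R * R)).
Hypothesis cK : closed K.
Local Notation d1 := (@partial1 R).
Local Notation d2 := (@partial2 R).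

Let vanish (f : R * R -> R) := forall p, ~ K p -> f p = 0.

Lemma vanish_derive v f : vanish f -> vanish ('D_v f).
Proof.
move=> f0 p Kp.
have /near_eq_derive -> : \near p, f p = (fun=> 0) p.
  have := open_nbhs_nbhs (conj (closed_openC cK) Kp).
  by apply: filterS => q; exact: f0.
exact: derive_cst.
Qed.

Lemma vanish_partial1 f : vanish f -> vanish (d1 f).
Proof. by rewrite partial1.unlock; exact: vanish_derive. Qed.

Lemma vanish_partial2 f : vanish f -> vanish (d2 f).
Proof. by rewrite partial2.unlock; exact: vanish_derive. Qed.

Variables (U F : R * R -> R).
Hypothesis F0 : vanish F.

Lemma vanish_field1 : vanish (field1 U F).
Proof. by move=> p Kp; rewrite /field1 /weight F0// !mul0r mulr0 mul0r addr0. Qed.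

Lemma vanish_field2 : vanish (field2 U F).
Proof. by move=> p Kp; rewrite /field2 /weight F0// !mul0r mulr0 mul0r addr0. Qed.

Lemma vanish_dissipation : vanish (dissipation U F).
Proof.
have W0 : vanish (weight U F) by move=> p Kp; rewrite /weight F0// mul0r mulr0.
move=> p Kp; rewrite /dissipation (vanish_partial1 F0 Kp) (vanish_partial2 F0 Kp).
by rewrite (vanish_partial1 W0 Kp) (vanish_partial2 W0 Kp) !mul0r !addr0.
Qed.

End Support.

Section PlaneInequality.
Variables (R : realType) (U F : R * R -> R) (B : R).
Hypotheses (sU : smooth_on setT U) (sF : smooth_on setT F) (B0 : 0 < B).
Hypothesis F0 : forall p, ~ square B p -> F p = 0.
Local Notation leb := (@lebesgue_measure R).

(** The two partial derivatives are those of compactly supported functions and integrate to zero,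
    which leaves minus the integral of a nonnegative function. *)
Lemma integral_jacobi_le0 :
  (\int[leb \x leb]_p (partial1 (field1 U F) p + partial2 (field2 U F) p
     - dissipation U F p)%:E <= 0)%E.
Proof.
have cS := @closed_square R B.
have sY1 := smooth_field1 sU sF; have sY2 := smooth_field2 sU sF.
have sq := smooth_dissipation sU sF.
have cont (f : R * R -> R) : smooth_on setT f -> continuous f.
  by move=> fs p; exact: smooth_on_continuous fs I.
have c1 := cont _ (smooth_partial1 sY1); have c2 := cont _ (smooth_partial2 sY2).
have cq := cont _ sq.
have v1 := vanish_field1 (K := square B) U F0.
have v2 := vanish_field2 (K := square B) U F0.
have w1 := vanish_partial1 cS v1; have w2 := vanish_partial2 cS v2.
have vq := vanish_dissipation cS U F0.
have i1 := continuous_square_integrable c1 w1.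
have i2 := continuous_square_integrable c2 w2.
have iq := continuous_square_integrable cq vq.
have E1 := integral_partial1 B0 c1
  (fun p => DeriveDef (smooth_on_derivable sY1 I) (partial1E _ p)) v1 w1.
have E2 := integral_partial2 B0 c2
  (fun p => DeriveDef (smooth_on_derivable sY2 I) (partial2E _ p)) v2 w2.
under eq_integral do rewrite EFinB EFinD.
rewrite integralB//; last exact: integrableD.
rewrite integralD// E1 E2 adde0 sub0e leeNl oppe0.
by apply: integral_ge0 => p _; rewrite lee_fin dissipation_ge0.
Qed.

End PlaneInequality.

(** * Surfaces that are graphs *)

Section GraphSurface.
Variables (R : realType) (M : oriented_surface R) (U : R * R -> R) (c : R * R).
Variables (psi : M -> R * R) (V : set (R * R)).
Hypotheses (sU : smooth_on setT U) (psi_cont : continuous psi).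
Hypotheses (immE : forall s, imm s = graph_map U c (psi s))
  (imm_inj : injective (@imm R M)).
Hypotheses (oV : open V) (Vpos : forall p, V p -> 0 < p.2).
Hypotheses (Vsurj : forall p, V p -> exists s, psi s = p)
  (Vcl : forall s, closure V (psi s)).
Local Notation d1 := (@partial1 R).
Local Notation d2 := (@partial2 R).
Local Notation w := (slope_inv U).
Local Notation n1 := (tilt1 U).
Local Notation n2 := (tilt2 U).
Local Notation Q := (graph_curv U).
Local Notation X := (graph_map U c).
Local Notation nu := (graph_normal U).

Lemma psi_inj : injective psi.
Proof. by move=> s t st; apply: imm_inj; rewrite !immE st. Qed.

(* An arbitrary point outside [V]. *)
Definition chart (p : R * R) : M := get [set s | psi s = p].

Lemma chartK p : V p -> psi (chart p) = p.
Proof.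
move=> /Vsurj[s sp]; rewrite /chart.
by have := @getPex _ [set s | psi s = p] (ex_intro _ s sp).
Qed.

Lemma psiK s : V (psi s) -> chart (psi s) = s.
Proof. by move=> Vs; apply: psi_inj; rewrite chartK. Qed.

Lemma halfV : Defs.half V = V.
Proof. by apply/seteqP; split=> [p []//|p Vp]; split=> //=; exact/ltW/Vpos. Qed.

Lemma chart_image (A : set (R * R)) : A `<=` V -> chart @` A = psi @^-1` A.
Proof.
move=> AV; apply/seteqP; split=> [_ [p Ap <-]|s As] /=.
  by rewrite chartK//; exact: AV.
by exists (psi s) => //; rewrite psiK//; exact: AV.
Qed.

Lemma closed_psi_image (C : set M) : closed C -> closed (psi @` C).
Proof.
move=> cC; apply: compact_closed; first exact: norm_hausdorff.
apply: continuous_compact; first exact: continuous_subspaceT.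
by apply: (subclosed_compact cC (@surf_compact R M)).
Qed.

(** [psi] is a closed map, M being compact. A point of [V] outside the closed image of the
    complement of [G] has its inverse image in [G], so the inverse of [psi] is continuous on [V]. *)
Lemma chart_continuous p : V p -> {for p, continuous chart}.
Proof.
move=> Vp N; rewrite nbhsE => -[G [oO Op] ON].
have cO : closed (psi @` (~` G)) by apply: closed_psi_image; exact: open_closedC.
have pO : (~` (psi @` (~` G))) p.
  by move=> [s nOs sp]; apply: nOs; rewrite -(psiK (s := s)) sp.
have op : open_nbhs p (~` (psi @` (~` G)) `&` V).
  by split; [apply: openI => //; exact: closed_openC|split].
change (nbhs p (chart @^-1` N)).
rewrite nbhsE; exists (~` (psi @` (~` G)) `&` V) => // q [qO Vq].
apply: ON; apply: contrapT => nO.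
exact: (qO (ex_intro2 _ _ (chart q) nO (chartK Vq))).
Qed.

(** The image under [psi] of the set where [f] and [g] agree is closed and contains [V], hence its
    closure; injectivity of [psi] then gives agreement at every point, boundary included. *)
Lemma dense_interior (f g : M -> R) : continuous f -> continuous g ->
  (forall s, V (psi s) -> f s = g s) -> forall s, f s = g s.
Proof.
move=> cf cg fg s.
pose C := [set s | f s - g s = 0].
have cC : closed C.
  apply: (@closed_comp _ _ (fun s => f s - g s) [set x : R | x = 0]).
    by move=> x _; apply: continuousB; [exact: cf|exact: cg].
  exact: closed_eq.
have VC : V `<=` psi @` C.
  move=> p Vp; exists (chart p); last exact: chartK.
  by rewrite /C/= fg ?subrr// chartK.
have [t Ct /psi_inj <-] : (psi @` C) (psi s).
  exact: (closed_psi_image cC (closure_subset VC (@Vcl s))).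
by apply/eqP; rewrite -subr_eq0; apply/eqP.
Qed.

Lemma chart_local_param : local_param (@imm R M) V chart X.
Proof.
split.
- exact: oV.
- exact: (smooth_onS (@subsetT _ V) (smooth_graph_map sU c)).
- by rewrite halfV => p Vp; rewrite immE chartK.
- move=> p _ v; rewrite (derive_graph_map sU) => v0.
  have := congr1 (fun x : 'rV[R]_3 => x 0 0) v0.
  have := congr1 (fun x : 'rV[R]_3 => x 0 1) v0.
  by rewrite !vec3E !mxE; case: v {v0} => x y /= -> ->.
- rewrite halfV => p q; rewrite !inE => Vp Vq pq.
  by rewrite -(chartK Vp) -(chartK Vq) pq.
- rewrite halfV; apply/continuous_in_subspaceT => p; rewrite inE.
  exact: chart_continuous.
- move=> G oG; rewrite halfV chart_image; last by move=> p [].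
  have /continuousP := psi_cont; apply; exact: openI.
Qed.

Lemma dot_graph_normal p : dot (nu p) (nu p) = 1.
Proof.
rewrite dot_vec3 /tilt1 /tilt2 -(slope_inv_sqr U p).
by move: (w p) (d1 U p) (d2 U p) => W x y; ring.
Qed.

Lemma gauss_chart p : V p ->
  exists eps : R, eps ^+ 2 = 1 /\ gauss (chart p) = eps *: nu p.
Proof.
move=> Vp; have hVp : Defs.half V p by rewrite halfV.
have N1 := gauss_normal chart_local_param hVp (1, 0).
have N2 := gauss_normal chart_local_param hVp (0, 1).
have N0 := gauss_unit (chart p).
move: N1 N2 N0; rewrite !(derive_graph_map sU) partial1E partial2E [gauss _]vec3P.
rewrite !dot_vec3 /=.
move: (gauss (chart p) 0 0) (gauss (chart p) 0 1) (gauss (chart p) 0 2) => x y z.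
rewrite /graph_normal /tilt1 /tilt2.
have := slope_inv_sqr U p; have := slope_inv_gt0 U p.
move: (w p) (d1 U p) (d2 U p) => W A B W0 W1 E1 E2 E0.
have Wn0 : W != 0 by exact: lt0r_neq0.
have xE : x = - (A * z) by lra.
have yE : y = - (B * z) by lra.
(* Here [W] stands for [w p]. Orthogonality to the two tangent vectors makes the horizontal part of
   the normal -z DU, so the ratio to [nu] is read off the vertical components z and [w p]. *)
exists (z / W); split.
  rewrite expr_div_n; apply: (mulIf (expf_neq0 2 Wn0)).
  rewrite mulfVK ?expf_neq0// mul1r -[RHS]mulr1 -E0 -[LHS]mulr1 -[X in _ * X = _]W1 xE yE.
  by ring.
apply/rowP => k; rewrite !mxE.
case: k => -[|[|[|k]]] i //=.
- by rewrite xE; field.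
- by rewrite yE; field.
- by field.
Qed.

Lemma gauss_dot_continuous : continuous (fun s : M => dot (gauss s) (nu (psi s))).
Proof.
move=> s; apply: continuous_dot; first exact: gauss_cont.
apply: (@continuous_comp _ _ _ psi nu); first exact: psi_cont.
have sn := smooth_on_vec3 (smooth_mul (smooth_cst (- 1)) (smooth_tilt1 sU))
  (smooth_mul (smooth_cst (- 1)) (smooth_tilt2 sU)) (smooth_slope_inv sU).
have := smooth_on_continuous sn (I : [set: R * R] (psi s)).
by rewrite (_ : (fun _ => _) = nu)//; apply/funext => p; rewrite !mulN1r.
Qed.

Hypothesis M_connected : connected [set: M].

(** The function <N, nu> is continuous with square 1, first over [V] and then everywhere by density,
    so connectedness makes it a constant eps. Then |N - eps nu|^2 = 1 - 2 eps^2 + eps^2 = 0. *)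
Lemma gauss_graph : exists eps : R, eps ^+ 2 = 1 /\ forall s, gauss s = eps *: nu (psi s).
Proof.
pose f (s : M) := dot (gauss s) (nu (psi s)).
have cf : continuous f := gauss_dot_continuous.
have f2 s : f s ^+ 2 = 1.
  apply: (dense_interior (f := fun s => f s ^+ 2) (g := fun=> 1)).
  - by move=> t; apply: continuousM; exact: cf.
  - by move=> t; exact: cvg_cst.
  - move=> t Vt; rewrite /f -{1}(psiK Vt) ; have [eps [eps1 ->]] := gauss_chart Vt.
    by rewrite dotZl dot_graph_normal mulr1.
have f1 s : f s = 1 \/ f s = -1.
  have : (f s - 1) * (f s + 1) == 0 by rewrite -subr_sqr f2 expr1n subrr.
  by rewrite mulf_eq0 => /orP[|]; rewrite ?subr_eq0 ?addr_eq0 => /eqP ->; [left|right].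
have fg eps s : eps ^+ 2 = 1 -> f s = eps -> gauss s = eps *: nu (psi s).
  move=> eps1 fs; apply/eqP; rewrite -subr_eq0; apply/eqP/dot_eq0.
  rewrite dot_sub_scale gauss_unit dot_graph_normal -/(f s) fs -mulrA -expr2 eps1.
  by ring.
have [[s0 s0P]|no] := pselect (exists s, f s = 1); last first.
  exists (- 1); rewrite sqrrN expr1n; split => // s; apply: fg; rewrite ?sqrrN ?expr1n//.
  by case: (f1 s) => // fs; case: no; exists s.
exists 1; rewrite expr1n; split => // s; apply: fg; first by rewrite expr1n.
(* This set is open, and also closed: as [f] takes only the values 1 and -1, it equals the set where
   [f] is nonnegative. *)
have f_pos : [set t | 0 < f t] = [set: M].
  apply: M_connected.
  - by exists s0; rewrite /= s0P.
  - exists [set t | 0 < f t]; last by rewrite setTI.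
    by have /continuousP /(_ _ (@open_gt R 0)) := cf.
  - exists [set t | 0 <= f t].
      apply: (@closed_comp _ _ f [set x : R | 0 <= x]); last exact: closed_ge.
      by move=> t _; exact: cf.
    rewrite setTI; apply/seteqP; split=> t /=; first exact: ltW.
    by case: (f1 t) => -> //; rewrite oppr_ge0 ler10.
have : [set t | 0 < f t] s by rewrite f_pos.
by move=> /= fs0; case: (f1 s) => // fs; move: fs0; rewrite fs oppr_gt0 ltr10.
Qed.

Variables a b : R.
Hypothesis curv : forall V' phi X', local_param (@imm R M) V' phi X' ->
  forall p, Defs.half V' p ->
    2 * mean_curv X' (gauss (phi p)) p = a * rsq (imm (phi p)) + b.

Lemma smooth_rsq_graph : smooth_on setT (fun p => rsq (X p)).
Proof.
have s1 := smooth_add (@smooth_fst R) (smooth_cst (- c.1)).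
have s2 := smooth_add (@smooth_snd R) (smooth_cst (- c.2)).
have := smooth_add (smooth_mul s1 s1) (smooth_mul s2 s2).
rewrite (_ : (fun p => rsq (X p)) = fun p =>
  (p.1 - c.1) * (p.1 - c.1) + (p.2 - c.2) * (p.2 - c.2))//.
by apply/funext => p; rewrite /rsq /x1 /x2 !vec3E !expr2.
Qed.

Lemma graph_curv_interior eps p : (forall s, gauss s = eps *: nu (psi s)) -> V p ->
  eps * Q p = a * rsq (X p) + b.
Proof.
move=> gaussE Vp; have hVp : Defs.half V p by rewrite halfV.
have := curv chart_local_param hVp.
by rewrite gaussE (chartK Vp) (mean_curv_graph sU) immE (chartK Vp).
Qed.

(** Both sides are continuous on the plane, so equality passes to the limit. Boundary points of
    either surface lie over the closure, and the calibration is evaluated there too. *)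
Lemma graph_curv_closure eps p : (forall s, gauss s = eps *: nu (psi s)) ->
  closure V p -> eps * Q p = a * rsq (X p) + b.
Proof.
move=> gaussE Vp.
pose f q := eps * Q q + (- 1 * (a * rsq (X q)) + - b).
have fs : smooth_on setT f.
  apply: smooth_add (smooth_mul (smooth_cst _) (smooth_graph_curv sU)) _.
  apply: smooth_add _ (smooth_cst _); apply: smooth_mul (smooth_cst _) _.
  exact: smooth_mul (smooth_cst _) smooth_rsq_graph.
have cf0 : closed [set q | f q = 0].
  apply: (@closed_comp _ _ f [set x : R | x = 0]); last exact: closed_eq.
  by move=> q _; exact: smooth_on_continuous fs I.
have Vf : V `<=` [set q | f q = 0].
  by move=> q Vq; rewrite /f/= (graph_curv_interior gaussE Vq); ring.
have := cf0 _ (closure_subset Vf Vp); rewrite /f/=; lra.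
Qed.

End GraphSurface.

(** * Strong stability of a graph *)

Section GraphStability.
Variables (R : realType) (M : oriented_surface R) (U : R * R -> R) (c : R * R).
Variables (psi : M -> R * R) (V : set (R * R)).
Hypotheses (sU : smooth_on setT U) (psi_cont : continuous psi).
Hypotheses (immE : forall s, imm s = graph_map U c (psi s))
  (imm_inj : injective (@imm R M)).
Hypotheses (oV : open V) (Vpos : forall p, V p -> 0 < p.2).
Hypotheses (Vsurj : forall p, V p -> exists s, psi s = p)
  (Vint : forall s, ~ boundary s -> V (psi s)).
Variables (eps a b : R).
Hypotheses (eps1 : eps ^+ 2 = 1) (gaussE : forall s, gauss s = eps *: graph_normal U (psi s)).
Hypothesis curv : forall p, V p -> eps * graph_curv U p = a * rsq (graph_map U c p) + b.
Local Notation d1 := (@partial1 R).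
Local Notation d2 := (@partial2 R).
Local Notation w := (slope_inv U).
Local Notation n1 := (tilt1 U).
Local Notation n2 := (tilt2 U).
Local Notation Q := (graph_curv U).
Local Notation X := (graph_map U c).
Local Notation chart := (chart psi).
Local Notation leb := (@lebesgue_measure R).

Let param : local_param (@imm R M) V chart X :=
  chart_local_param sU psi_cont immE imm_inj oV Vpos Vsurj.

Lemma graph_curv_derive v p : V p ->
  eps * 'D_v Q p = 2 * a * ((p.1 - c.1) * v.1 + (p.2 - c.2) * v.2).
Proof.
move=> Vp.
have s1 := smooth_add (@smooth_fst R) (smooth_cst (- c.1)).
have s2 := smooth_add (@smooth_snd R) (smooth_cst (- c.2)).
have s12 := smooth_add (smooth_mul s1 s1) (smooth_mul s2 s2).
pose f (q : R * R) := a * ((q.1 + - c.1) * (q.1 + - c.1) + (q.2 + - c.2) * (q.2 + - c.2)) + b.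
have d0 k : 'D_v (fun _ : R * R => k : R) p = 0 by exact: derive_cst.
have <- : 'D_v (fun q => eps * Q q) p = eps * 'D_v Q p.
  by rewrite (derive_smooth_mul _ _ (smooth_cst _) (smooth_graph_curv sU)) d0 mulr0 addr0.
have -> : 'D_v (fun q => eps * Q q) p = 'D_v f p.
  apply: near_eq_derive.
  have := open_nbhs_nbhs (conj oV Vp); apply: filterS => q Vq.
  by rewrite curv// /rsq /x1 /x2 !vec3E /f !expr2.
rewrite /f (derive_smooth_add _ _ (smooth_mul (smooth_cst a) s12) (smooth_cst b)).
rewrite (derive_smooth_mul _ _ (smooth_cst a) s12).
rewrite (derive_smooth_add _ _ (smooth_mul s1 s1) (smooth_mul s2 s2)).
rewrite (derive_smooth_mul _ _ s1 s1) (derive_smooth_mul _ _ s2 s2).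
rewrite (derive_smooth_add _ _ (@smooth_fst R) (smooth_cst (- c.1))).
rewrite (derive_smooth_add _ _ (@smooth_snd R) (smooth_cst (- c.2))).
by rewrite !d0 derive_fst derive_snd; ring.
Qed.

(** Removing x_3 N_3 from <N, x> leaves the horizontal part -eps <DU / W, (x_1, x_2)>, while
    differentiating eps Q = a r^2 + b gives eps DQ = 2a (x_1, x_2). The two occurrences of eps
    cancel. *)
Lemma graph_potential s : V (psi s) ->
  - (2 * a * (support_fun s - x3 (imm s) * N3 s)) =
  n1 (psi s) * d1 Q (psi s) + n2 (psi s) * d2 Q (psi s).
Proof.
move=> Vs; set p := psi s.
have E1 := graph_curv_derive (1, 0) Vs; have E2 := graph_curv_derive (0, 1) Vs.
move: E1 E2; rewrite partial1E partial2E /= -/p !mulr0 !mulr1 addr0 add0r => E1 E2.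
rewrite N3E /support_fun gaussE immE dotE !mxE /= /x3 vec3E /= -/p.
transitivity (eps * (n1 p * (2 * a * (p.1 - c.1)) + n2 p * (2 * a * (p.2 - c.2)))).
  by ring.
rewrite -E1 -E2.
transitivity (eps ^+ 2 * (n1 p * d1 Q p + n2 p * d2 Q p)); first by ring.
by rewrite eps1 mul1r.
Qed.

Lemma psi_measurable : measurable_fun [set: borel M]
  (psi : borel M -> measurableTypeR R * measurableTypeR R).
Proof.
apply/measurable_fun_pairP; split; apply: continuous_surface_measurable => s.
  by apply: (@continuous_comp _ _ _ psi fst); [exact: psi_cont|exact: cvg_fst].
by apply: (@continuous_comp _ _ _ psi snd); [exact: psi_cont|exact: cvg_snd].
Qed.

(** For [A] inside [V] the preimage by [psi] is the image by [chart], so the area measure pushed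
    forward by [psi] has density [area_density X] on [V]. *)
Lemma integral_graph (G : R * R -> R) : continuous G -> (forall p, ~ V p -> G p = 0) ->
  (\int[area M]_s (G (psi s))%:E =
   \int[leb \x leb]_(p in V) ((G p)%:E * (area_density X p)%:E))%E.
Proof.
move=> cG G0.
have mV : measurable (V : set (measurableTypeR R * measurableTypeR R)).
  exact: open_plane_measurable.
have mw : measurable_fun (V : set (measurableTypeR R * measurableTypeR R))
    (fun p => (area_density X p)%:E).
  apply: measurableT_comp => //; apply: open_continuous_plane_measurable => // p Vp.
  exact: area_density_continuous (smooth_onS (@subsetT _ V) (smooth_graph_map sU c)) Vp.
have muw (A : set (measurableTypeR R * measurableTypeR R)) : measurable A -> A `<=` V ->
    area M (psi @^-1` A) = (\int[@plane_measure R]_(p in A) (area_density X p)%:E)%E.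
  move=> mA AV; rewrite -(chart_image immE imm_inj Vsurj AV).
  by rewrite (area_param param mA)// (halfV Vpos).
have mG : measurable_fun [set: measurableTypeR R * measurableTypeR R] (EFin \o G).
  by apply: measurableT_comp => //; exact: continuous_plane_measurable.
have iG : (area M).-integrable [set: borel M] ((EFin \o G) \o psi).
  apply: (continuous_surface_integrable (f := fun s => G (psi s))) => s.
  by apply: (@continuous_comp _ _ _ psi G); [exact: psi_cont|exact: cG].
have G0' p : ~ V p -> (EFin \o G) p = 0%E by move=> Vp; rewrite /= G0.
exact: (integral_pushforward_density psi_measurable mV (area_finite M) mw muw mG iG G0').
Qed.

Lemma graph_strongly_stable : strongly_stable M a.
Proof.
move=> q f Lf qE [fsm fK Kint] LfE.
(* A test function stays away from the boundary of M, so its projected support is a compact subset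
   of the open set [V]. *)
pose S := closure [set s | f s != 0]; pose K := psi @` S.
have cptK : compact K.
  by apply: continuous_compact => //; exact: continuous_subspaceT.
have cK : closed K by apply: compact_closed => //; exact: norm_hausdorff.
have KV : K `<=` V by move=> _ [s Ss <-]; apply: Vint; exact: Kint.
have fS s : ~ K (psi s) -> f s = 0.
  move=> nK; apply: contrapT => /eqP fs; apply: nK; exists s => //.
  exact: subset_closure.
have [F0 [F0s F0E]] := fsm _ _ _ param.
have cV : Defs.half V = V by exact: halfV.
have chK p : V p -> psi (chart p) = p by exact: chartK.
(* [F0] is controlled only on [V]; cutting it off outside makes a function smooth on the whole plane
   with compact support. *)
pose F := zero_extension V F0.
have sF : smooth_on setT F.
  apply: smooth_on_zero_extension oV cK KV F0s _ => p Vp Kp.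
  by rewrite F0E ?cV// fS// chK.
have FE s : V (psi s) -> F (psi s) = f s.
  move=> Vs; rewrite /F /zero_extension mem_set// F0E ?cV//.
  by rewrite (psiK immE imm_inj Vsurj Vs).
have Fcoord : coord_expr f V chart F.
  split; first exact: smooth_onS (@subsetT _ V) sF.
  by move=> p; rewrite cV => Vp; rewrite -{1}(chK p Vp) FE// chK.
have F0K p : ~ K p -> F p = 0.
  move=> Kp; rewrite /F /zero_extension; case: ifPn => //; rewrite inE => Vp.
  by rewrite F0E ?cV// fS// chK.
pose D p := d1 (field1 U F) p + d2 (field2 U F) p - dissipation U F p.
have DK p : ~ K p -> D p = 0.
  move=> Kp; rewrite /D (vanish_partial1 cK (vanish_field1 U F0K) Kp).
  rewrite (vanish_partial2 cK (vanish_field2 U F0K) Kp).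
  by rewrite (vanish_dissipation cK U F0K Kp) addr0 subr0.
pose G p := w p * D p.
have kE s : f s * (Lf s + (q s - 2 * a * (support_fun s - x3 (imm s) * N3 s)) * f s) =
    G (psi s).
  have [Vs|nVs] := pselect (V (psi s)); last first.
    have nK : ~ K (psi s) by move=> /KV.
    by rewrite /G (fS _ nK) (DK _ nK) mul0r mulr0.
  have hVs : Defs.half V (psi s) by rewrite cV.
  have sE := psiK immE imm_inj Vsurj Vs.
  have := jacobi_identity sU sF c (psi s) eps1.
  rewrite -/(D _) -/(G _) => <-; rewrite FE//.
  have := LfE _ _ _ _ param Fcoord _ hVs; rewrite sE => ->.
  have := qE _ _ _ param _ hVs; rewrite sE gaussE => ->.
  by rewrite (graph_potential Vs).
have [B B0 KB] := compact_sub_square cptK.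
have FB p : ~ square B p -> F p = 0 by move=> nB; apply: F0K => /KB.
have cont (h : R * R -> R) : smooth_on setT h -> continuous h.
  by move=> hs p; exact: smooth_on_continuous hs I.
have cG : continuous G.
  have sY1 := smooth_partial1 (smooth_field1 sU sF).
  have sY2 := smooth_partial2 (smooth_field2 sU sF).
  have sd := smooth_mul (smooth_cst (-1)) (smooth_dissipation sU sF).
  have := smooth_mul (smooth_slope_inv sU) (smooth_add (smooth_add sY1 sY2) sd).
  rewrite (_ : (fun p => w p * _) = G); first exact: cont.
  by apply/funext => p; rewrite /G /D mulN1r.
have GV p : ~ V p -> G p = 0 by move=> Vp; rewrite /G DK ?mulr0// => /KV.
rewrite /Rintegral; under eq_integral do rewrite kE.
rewrite (integral_graph cG GV).
have -> : (\int[leb \x leb]_(p in V) ((G p)%:E * (area_density X p)%:E) =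
    \int[leb \x leb]_p (D p)%:E)%E.
  rewrite integral_mkcond; apply: eq_integral => p _; rewrite patchE.
  case: ifPn => [_|]; last by rewrite notin_setE => Vp; rewrite DK// => /KV.
  rewrite -EFinM (area_density_graph sU) /G mulrAC mulfV ?mul1r//.
  exact/lt0r_neq0/slope_inv_gt0.
rewrite oppr_ge0; apply: fine_le0.
exact: integral_jacobi_le0 sU sF B0 FB.
Qed.

End GraphStability.

(** * Energy *)

Section Calibration.
Variables (R : realType) (U : R * R -> R) (c : R * R) (eps : R).
Hypothesis sU : smooth_on setT U.
Local Notation w := (slope_inv U).
Local Notation n1 := (tilt1 U).
Local Notation n2 := (tilt2 U).
Local Notation Q := (graph_curv U).

(* Using [graph_curv] rather than a r^2 + b makes this field divergence free also
   outside the cylinder over the domain. *)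
Definition calibration (v : 'rV[R]_3) : 'rV[R]_3 :=
  let q := hproj v + c in
  vec3 (- eps * n1 q) (- eps * n2 q) (eps * (w q + x3 v * Q q)).

Let cylinder (f : R * R -> R) (v : 'rV[R]_3) := f (hproj v + c).

Lemma smooth_cylinder f : smooth_on setT f -> smooth_on setT (cylinder f).
Proof.
move=> fs; have := smooth_on_precomp (@hproj_continuous R) (smooth_on_shift (- c) fs).
by rewrite (_ : _ \o _ = cylinder f)//; apply/funext => v; rewrite /= opprK.
Qed.

Lemma derive_cylinder f v v' : 'D_v' (cylinder f) v = 'D_(hproj v') f (hproj v + c).
Proof.
by apply: eq_growth_derive => h; rewrite /cylinder linearD linearZ addrA.
Qed.

Let smooth_x3 : smooth_on setT (@x3 R).
Proof. exact: smooth_linear (@x3_continuous R). Qed.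

Let s1 :=
  smooth_mul (smooth_cst (V := 'rV[R]_3) (- eps)) (smooth_cylinder (smooth_tilt1 sU)).
Let s2 :=
  smooth_mul (smooth_cst (V := 'rV[R]_3) (- eps)) (smooth_cylinder (smooth_tilt2 sU)).
Let sQ := smooth_mul smooth_x3 (smooth_cylinder (smooth_graph_curv sU)).
Let s3' := smooth_add (smooth_cylinder (smooth_slope_inv sU)) sQ.
Let s3 := smooth_mul (smooth_cst (V := 'rV[R]_3) eps) s3'.

Lemma smooth_calibration : smooth_on setT calibration.
Proof. exact: smooth_on_vec3 s1 s2 s3. Qed.

(** The horizontal components contribute -eps div (DU / W), the vertical one eps Q because [w] and Q
    do not depend on x_3; the two cancel by definition of Q. *)
Lemma divergence_calibration v : divergence calibration v = 0.
Proof.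
have E k : 'D_(delta_mx 0 k) calibration v = vec3
   (- eps * 'D_(hproj (delta_mx 0 k)) n1 (hproj v + c))
   (- eps * 'D_(hproj (delta_mx 0 k)) n2 (hproj v + c))
   (eps * ('D_(hproj (delta_mx 0 k)) w (hproj v + c) +
     (x3 v * 'D_(hproj (delta_mx 0 k)) Q (hproj v + c) +
      Q (hproj v + c) * x3 (delta_mx 0 k)))).
  have d0 e : 'D_(delta_mx 0 k) (fun _ : 'rV[R]_3 => e : R) v = 0 by exact: derive_cst.
  rewrite /calibration (derive_vec3 (smooth_on_derivable s1 I)
    (smooth_on_derivable s2 I) (smooth_on_derivable s3 I)).
  congr vec3.
  - rewrite (derive_smooth_mul _ _ (smooth_cst _) (smooth_cylinder (smooth_tilt1 sU))).
    by rewrite d0 mulr0 addr0 derive_cylinder.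
  - rewrite (derive_smooth_mul _ _ (smooth_cst _) (smooth_cylinder (smooth_tilt2 sU))).
    by rewrite d0 mulr0 addr0 derive_cylinder.
  - rewrite (derive_smooth_mul _ _ (smooth_cst _) s3') d0 mulr0 addr0.
    rewrite (derive_smooth_add _ _ (smooth_cylinder (smooth_slope_inv sU)) sQ) derive_cylinder.
    rewrite (derive_smooth_mul _ _ smooth_x3 (smooth_cylinder (smooth_graph_curv sU))).
    rewrite derive_cylinder.
    by rewrite (derive_linear _ _ (@x3_continuous R)).
have h0 : hproj (delta_mx 0 0 : 'rV[R]_3) = (1, 0) by rewrite /hproj /x1 /x2 !mxE.
have h1 : hproj (delta_mx 0 1 : 'rV[R]_3) = (0, 1) by rewrite /hproj /x1 /x2 !mxE.
have h2 : hproj (delta_mx 0 2 : 'rV[R]_3) = 0 by rewrite /hproj /x1 /x2 !mxE.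
have x32 : x3 (delta_mx 0 2 : 'rV[R]_3) = 1 by rewrite /x3 !mxE.
have -> : divergence calibration v = 'D_(delta_mx 0 0) calibration v 0 0 +
   'D_(delta_mx 0 1) calibration v 0 1 + 'D_(delta_mx 0 2) calibration v 0 2.
  rewrite /divergence !big_ord_recl big_ord0 addr0 addrA.
  have -> : lift ord0 (ord0 : 'I_2) = 1 :> 'I_3 by exact: val_inj.
  by have -> : lift ord0 (lift ord0 (ord0 : 'I_1)) = 2 :> 'I_3 by exact: val_inj.
rewrite (E 0) (E 1) (E 2) h0 h1 h2 x32 !vec3E partial1E partial2E !derive0.
rewrite /graph_curv; move: (partial1 _ _) (partial2 _ _) => A B; ring.
Qed.

Lemma dot_calibration v (n : 'rV[R]_3) : dot (calibration v) n =
  eps * dot (graph_normal U (hproj v + c)) n + x3 v * (eps * Q (hproj v + c)) * n 0 2.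
Proof. by rewrite !dotE /calibration /graph_normal !vec3E; ring. Qed.

End Calibration.

Section EnergyComparison.
Variables (R : realType) (U : R * R -> R) (c : R * R) (V : set (R * R)).
Variables (eps a b : R).
Hypotheses (sU : smooth_on setT U) (eps1 : eps ^+ 2 = 1).
Hypothesis curv : forall p, closure V p ->
  eps * graph_curv U p = a * rsq (graph_map U c p) + b.

Lemma rsq_graph_map (v : 'rV[R]_3) : rsq (graph_map U c (hproj v + c)) = rsq v.
Proof. by rewrite /rsq /x1 /x2 !vec3E /= !addrK. Qed.

(** Equality case of the calibration bound: N = eps nu, so the term eps <nu, N> equals 1 and the
    rest is the potential part of the energy density. *)
Lemma flux_calibration_graph (M : oriented_surface R) :
  (forall s : M, gauss s = eps *: graph_normal U (hproj (imm s) + c)) ->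
  (forall s : M, closure V (hproj (imm s) + c)) ->
  flux M (calibration U c eps) = energy a b M.
Proof.
move=> gaussE Vcl; rewrite energyE /flux; congr fine; apply: eq_integral => s _; congr EFin.
rewrite dot_calibration (curv (@Vcl s)) rsq_graph_map /energy_density N3E gaussE.
rewrite (_ : dot _ _ = eps * 1); last first.
  by rewrite -(dot_graph_normal U (hproj (imm s) + c)) !dotE !mxE; ring.
by rewrite mulr1 -expr2 eps1 mxE; ring.
Qed.

(** For unit vectors the Cauchy-Schwarz bound is the expansion of |n - eps nu|^2 >= 0. *)
Lemma dot_graph_normal_le (p : R * R) (n : 'rV[R]_3) : dot n n = 1 ->
  eps * dot (graph_normal U p) n <= 1.
Proof.
move=> n1.
have : 0 <= dot (n - eps *: graph_normal U p) (n - eps *: graph_normal U p).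
  by rewrite dotE !addr_ge0 // -expr2 sqr_ge0.
rewrite dot_sub_scale n1 dot_graph_normal eps1.
have -> : dot n (graph_normal U p) = dot (graph_normal U p) n by rewrite !dotE; ring.
by rewrite -mulrA; lra.
Qed.

Lemma flux_calibration_le (M : oriented_surface R) :
  (forall s : M, closure V (hproj (imm s) + c)) ->
  flux M (calibration U c eps) <= energy a b M.
Proof.
move=> Vcl; rewrite energyE /flux; apply: le_Rintegral.
- exact: measurableT.
- apply: (continuous_surface_integrable
    (f := fun s : M => dot (calibration U c eps (imm s)) (gauss s))) => s.
  apply: (continuous_dot (f := calibration U c eps \o @imm R M) (g := @gauss R M)).
    apply: continuous_comp; first exact: imm_continuous.
    exact: smooth_on_continuous (smooth_calibration c eps sU) I.
  exact: gauss_cont.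
- exact: (continuous_surface_integrable (@energy_density_continuous _ M a b)).
move=> s _; rewrite dot_calibration (curv (@Vcl s)) rsq_graph_map /energy_density N3E.
have := dot_graph_normal_le (hproj (imm s) + c) (gauss_unit s).
set A := eps * _ => A1.
rewrite -addrA lerD// le_eqVlt; apply/orP; left; apply/eqP; ring.
Qed.

End EnergyComparison.

Theorem theorem14 (R : realType) (M : oriented_surface R) (a b : R)
    (Omega : set (R * R)) (u : R * R -> R)
    (hM : stationary_rotating M a b)
    (hOmega : domain Omega)
    (hgraph : graph_on M Omega u) :
  strongly_stable M a /\
  forall M' : oriented_surface R,
    same_boundary M M' ->
    bound_chain M M' ->
    (forall s : M', ~ boundary s -> Omega (hproj (imm s))) ->
    energy a b M <= energy a b M'.
Proof.
have [Mconn curvM] := hM; have [oO _ _] := hOmega.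
have [su imm_inj intM allM] := hgraph.
have cp : continuous (fun s : M => hproj (imm s)).
  move=> s; apply: (@continuous_comp _ _ _ (@imm R M) (@hproj R)).
    exact: imm_continuous.
  exact: hproj_continuous.
have [B B0 KB] : exists2 B, 0 < B & [set hproj (imm s) | s in [set: M]] `<=` square B.
  apply: compact_sub_square; apply: continuous_compact; last exact: surf_compact.
  exact: continuous_subspaceT.
(* The projection of M lies in the square of half-side [B], so after this shift its second
   coordinate is at least 1. *)
pose c : R * R := (0, B + 1).
pose U p := u (p - c).
have sU : smooth_on setT U by exact: smooth_on_shift.
pose V := (fun p => p - c) @^-1` Omega.
pose psi (s : M) := hproj (imm s) + c.
have cshift : continuous (fun p : R * R => p - c).
  by move=> p; apply: continuousB; [exact: cvg_id|exact: cvg_cst].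
have oV : open V by have /continuousP := cshift; apply.
have caddc : continuous (fun q : R * R => q + c).
  by move=> q; apply: continuousD; [exact: cvg_id|exact: cvg_cst].
have clV p : closure Omega p -> closure V (p + c).
  move=> Op N Np.
  have : nbhs p ((fun q => q + c) @^-1` N).
    exact: (@caddc p N Np).
  move=> /Op[q [Oq Nq]]; exists (q + c); split => //.
  by rewrite /V/= addrK.
have imm_graph (s : M) : closure Omega (hproj (imm s)) /\ x3 (imm s) = u (hproj (imm s)).
  have : (@imm R M @` [set: M]) (imm s) by exists s.
  by rewrite allM.
have immE (s : M) : imm s = graph_map U c (psi s).
  have [_ h3] := imm_graph s.
  rewrite /graph_map /U /psi /= !addrK -h3; exact: vec3P.
have psi_cont : continuous psi.
  move=> s; apply: (@continuous_comp _ _ _ (fun s : M => hproj (imm s)) (fun q => q + c)).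
    exact: cp.
  exact: caddc.
have onV p : V p -> exists2 s : M, ~ boundary s & psi s = p.
  move=> Vp.
  have : graph Omega u (graph_map U c p).
    rewrite /graph/= /hproj /x1 /x2 /x3 !vec3E; split => //.
  rewrite -intM => -[s bs sE]; exists s => //.
  rewrite /psi sE /hproj /x1 /x2 !vec3E; case: (p) => x y.
  by rewrite /c /=; congr pair; rewrite /= subrK.
have Vsurj p : V p -> exists s, psi s = p by move=> /onV[s _]; exists s.
have Vint (s : M) : ~ boundary s -> V (psi s).
  move=> bs; have : (@imm R M @` (~` boundary (M := M))) (imm s) by exists s.
  by rewrite intM /V/= /psi addrK => -[].
have Vpos p : V p -> 0 < p.2.
  move=> /Vsurj[s <-]; have [_ /=] : square B (hproj (imm s)) by apply: KB; exists s.
  by rewrite /psi in_itv/= => /andP[]; lra.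
have Vcl (s : M) : closure V (psi s) by have [/clV] := imm_graph s.
have [eps [eps1 gaussE]] :=
  gauss_graph sU psi_cont immE imm_inj oV Vpos Vsurj Vcl Mconn.
have curvV := graph_curv_closure sU psi_cont immE imm_inj oV Vpos Vsurj curvM gaussE.
split.
  apply: (graph_strongly_stable sU psi_cont immE imm_inj oV Vpos Vsurj Vint eps1 gaussE).
  by move=> p Vp; apply: curvV; exact: subset_closure.
move=> M' sameB chain inside.
(* The energy of M is the flux of the calibration, which the 3-chain carries over to [M'], where it
   is bounded by the energy. *)
rewrite -(flux_calibration_graph eps1 curvV gaussE Vcl).
rewrite (chain _ (smooth_calibration c eps sU) (divergence_calibration c eps sU)).
suff M'cl (s : M') : closure V (hproj (imm s) + c).
  exact: (@flux_calibration_le _ U c V eps a b sU eps1 curvV M' M'cl).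
apply: clV.
(* Only the interior of [M'] is assumed to lie over Omega; a boundary point has the same image as a
   boundary point of M, and M lies over the closure. *)
have [bs|bs] := pselect (boundary s); last exact/subset_closure/inside.
have : (@imm R M' @` boundary (M := M')) (imm s) by exists s.
by rewrite -sameB => -[t _ <-]; have [] := imm_graph t.
Qed.
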